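(* Let $n\ge 4$ be an integer, let $1<p\le q<\infty$ and let $t\ge 0$. Then $$\|P_t f\|_q\le \|f\|_p\ \text{ for all } f:\mathbb{Z}_n\to\mathbb{C}\qquad\Longleftrightarrow\qquad t\ge \frac12\log\Big(\frac{q-1}{p-1}\Big).$$
   Context: $\mathbb{Z}_n=\{0,1,\dots,n-1\}$ is the cyclic group, equipped with the normalized counting measure $\mu_n$ (each point has mass $1/n$); $\|\cdot\|_p$ is the norm of $L_p(\mathbb{Z}_n,\mu_n)$, i.e. $\|f\|_p=\big(\frac1n\sum_{x}|f(x)|^p\big)^{1/p}$. Let $\chi_k(x)=e^{2\pi i kx/n}$ for $0\le k\le n-1$, and let $\psi_n(k)=\min(k,n-k)$ be the word length. The Poisson-like semigroup $(P_t)_{t\ge 0}$ acts on $f=\sum_{k=0}^{n-1}a_k\chi_k$ by $P_tf=\sum_{k=0}^{n-1}e^{-t\psi_n(k)}a_k\chi_k$. *)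

(* Defs.v *)
From mathcomp Require Import all_boot all_order all_algebra.
From mathcomp Require Import reals sequences exp trigo.
From mathcomp Require Import complex.
Set Implicit Arguments.
Unset Strict Implicit.
Unset Printing Implicit Defensive.

Import Order.TTheory GRing.Theory Num.Theory.
Local Open Scope ring_scope.
Local Open Scope complex_scope.

Definition cis (R : realType) (a : R) : R[i] := cos a +i* sin a.

(* 'Z_n is Z/nZ, with underlying set {0, ..., n - 1}, only when 1 < n: 'Z_0 and
   'Z_1 both have two elements. The definitions below are meant for 1 < n. *)

(* The product k * x is taken in nat, not modulo n. *)
Definition chi (R : realType) (n : nat) (k x : 'Z_n) : R[i] :=
  cis (2 * pi * (k * x)%N%:R / n%:R : R).

Definition wordlen (n : nat) (k : 'Z_n) : nat := minn k (n - k).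

(* (n^-1 \sum_x |f x|^p)^(1/p); used for 0 < p, where 0 `^ p = 0. *)
Definition Lpnorm (R : realType) (n : nat) (p : R) (f : 'Z_n -> R[i]) : R :=
  (n%:R^-1 * \sum_(x : 'Z_n) Normc.normc (f x) `^ p) `^ p^-1.

(* The coefficients a_k of f = \sum_k a_k chi_k, see fourier_inversion and
   fourier_coef_sum. *)
Definition fourier_coef (R : realType) (n : nat) (f : 'Z_n -> R[i]) (k : 'Z_n)
    : R[i] :=
  n%:R^-1 * \sum_(x : 'Z_n) f x * conjc (chi R k x).

Definition poisson_semigroup (R : realType) (n : nat) (t : R) (f : 'Z_n -> R[i])
    (x : 'Z_n) : R[i] :=
  \sum_(k : 'Z_n)
    (expR (- t * (wordlen k)%:R))%:C * fourier_coef f k * chi R k x.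

Lemma cisD (R : realType) (a b : R) : cis (a + b) = cis a * cis b.
Proof.
by rewrite /cis cosD sinD; simpc; congr (_ +i* _); rewrite addrC.
Qed.

Lemma cis0 (R : realType) : cis (0 : R) = 1.
Proof. by rewrite /cis cos0 sin0. Qed.

Lemma cisM (R : realType) (a : R) (m : nat) : cis (a * m%:R) = cis a ^+ m.
Proof.
elim: m => [|m IH]; first by rewrite mulr0 cis0 expr0.
by rewrite -natr1 mulrDr mulr1 cisD IH exprSr.
Qed.

Lemma cis_neq1 (R : realType) (a : R) : 0 < a < 2 * pi -> cis a != 1.
Proof.
move=> /andP[a0 a1]; apply/eqP => -[] hc _.
have sp : 0 < sin (a / 2).
  by apply: sin_gt0_pi; rewrite divr_gt0 //= ltr_pdivrMr // mulrC.
have : cos (a / 2 + a / 2) = 1 by rewrite -splitr.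
rewrite cosD -!expr2 cos2sin2 => /eqP.
rewrite -addrA -subr_eq0 addrAC subrr add0r -opprD oppr_eq0.
by rewrite gt_eqF // addr_gt0 // exprn_gt0.
Qed.

Lemma conj_cis (R : realType) (a : R) : conjc (cis a) = cis (- a).
Proof. by rewrite /cis cosN sinN. Qed.

Section fourier.
Variables (R : realType) (n : nat).
Hypothesis n1 : (1 < n)%N.

Let w : R[i] := cis (2 * pi / n%:R : R).

Let n0 : (0 < n%:R :> R). Proof. by rewrite ltr0n ltnW. Qed.

Let nC0 : (n%:R != 0 :> R[i]). Proof. by rewrite pnatr_eq0 -lt0n ltnW. Qed.

Let wn : w ^+ n = 1.
Proof.
rewrite /w -cisM divfK ?gt_eqF // mulrC /cis mulr_natr.
by rewrite cos2pi sin2pi.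
Qed.

Let w_neq1 (j : nat) : (0 < j < n)%N -> w ^+ j != 1.
Proof.
move=> /andP[j0 jn]; rewrite -cisM cis_neq1 //.
apply/andP; split; first by rewrite !mulr_gt0 ?invr_gt0 ?n0 ?pi_gt0 ?ltr0n.
by rewrite mulrAC ltr_pdivrMr // ltr_pM2l ?ltr_nat // mulr_gt0 ?pi_gt0.
Qed.

Lemma chiE (k x : 'Z_n) : chi R k x = w ^+ (k * x)%N.
Proof. by rewrite /w -cisM /chi mulrAC. Qed.

Lemma chiC (k x : 'Z_n) : chi R k x = chi R x k.
Proof. by rewrite !chiE mulnC. Qed.

Let sum_pow (v : R[i]) : v ^+ n = 1 -> v != 1 ->
  \sum_(x : 'Z_n) v ^+ x = 0.
Proof.
move=> vn v1; apply/(mulfI (x := v - 1)); first by rewrite subr_eq0.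
by rewrite mulr0 -subrX1 /= Zp_cast // vn subrr.
Qed.

Lemma chi_orth (j k : 'Z_n) :
  \sum_(x : 'Z_n) chi R j x * conjc (chi R k x) = n%:R *+ (j == k).
Proof.
have ww : w * conjc w = 1 by rewrite /w conj_cis -cisD subrr cis0.
have E x : chi R j x * conjc (chi R k x) = (w ^+ j * conjc w ^+ k) ^+ (x : 'Z_n).
  by rewrite !chiE rmorphXn exprMn -!exprM.
rewrite (eq_bigr _ (fun x _ => E x)).
have [->|jk] := eqVneq j k.
  under eq_bigr => x _ do rewrite -exprMn ww !expr1n.
  by rewrite sumr_const card_ord Zp_cast // mulr1n.
have wz (m : nat) : w ^+ m * conjc w ^+ m = 1 by rewrite -exprMn ww expr1n.
have ltn (i : 'Z_n) : (i < n)%N by rewrite -[X in (_ < X)%N](Zp_cast n1).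
have wcn : conjc w ^+ n = 1 by rewrite -[LHS]mul1r -{1}wn wz.
rewrite mulr0n; apply: sum_pow.
  by rewrite exprMn -!exprM mulnC [(k * n)%N]mulnC !exprM wn wcn !expr1n mulr1.
have [lt|lt|eq] := ssrnat.ltngtP j k; last by rewrite -val_eqE /= eq eqxx in jk.
- have := @w_neq1 (k - j)%N; rewrite subn_gt0 lt.
  rewrite (leq_ltn_trans (leq_subr _ _) (ltn k)) => /(_ isT).
  apply: contraNneq => h; apply/eqP.
  have : w ^+ (k - j) * w ^+ j * conjc w ^+ k = 1.
    by rewrite -exprD (ssrnat.subnK (ltnW lt)) wz.
  by rewrite -mulrA h mulr1.
- have := @w_neq1 (j - k)%N; rewrite subn_gt0 lt.
  rewrite (leq_ltn_trans (leq_subr _ _) (ltn j)) => /(_ isT).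
  apply: contraNneq => h; apply/eqP; rewrite -[RHS]h.
  by rewrite -{2}(ssrnat.subnK (ltnW lt)) exprD -mulrA wz mulr1.
Qed.

Lemma fourier_inversion (f : 'Z_n -> R[i]) (x : 'Z_n) :
  f x = \sum_(k : 'Z_n) fourier_coef f k * chi R k x.
Proof.
under eq_bigr => k _.
  rewrite /fourier_coef -mulrA mulr_suml.
  under eq_bigr => y _ do
    rewrite -mulrA [conjc _ * _]mulrC (chiC k x) (chiC k y).
  over.
rewrite -mulr_sumr exchange_big /=.
under eq_bigr => y _ do rewrite -mulr_sumr chi_orth.
rewrite (bigD1 x) //= eqxx big1 ?addr0 => [|y /negbTE yx].
  by rewrite mulrCA mulVf // mulr1.
by rewrite eq_sym yx mulr0.
Qed.

Lemma fourier_coef_sum (a : 'Z_n -> R[i]) (k : 'Z_n) :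
  fourier_coef (fun x => \sum_(j : 'Z_n) a j * chi R j x) k = a k.
Proof.
rewrite /fourier_coef; under eq_bigr => x _ do rewrite mulr_suml.
rewrite exchange_big /=.
under eq_bigr => j _.
  under eq_bigr => x _ do rewrite -mulrA.
  rewrite -mulr_sumr chi_orth.
  over.
rewrite (bigD1 k) //= eqxx big1 ?addr0 => [|j /negbTE ->]; last by rewrite mulr0.
by rewrite mulrCA mulVf // mulr1.
Qed.

Lemma poisson_semigroup_sum (t : R) (a : 'Z_n -> R[i]) (x : 'Z_n) :
  poisson_semigroup t (fun y => \sum_(k : 'Z_n) a k * chi R k y) x =
  \sum_(k : 'Z_n) (expR (- t * (wordlen k)%:R))%:C * a k * chi R k x.
Proof. by apply: eq_bigr => k _; rewrite fourier_coef_sum. Qed.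

End fourier.

(* Main.v *)
(* Sufficiency is Gross's argument: the log-Sobolev inequality
   Ent(f^2) <= 2 <f, L f>, with L the Fourier multiplier k |-> psi k, together
   with the Stroock-Varopoulos inequality (L has nonpositive off-diagonal
   entries) makes ||P_s f||_(q(s)) nonincreasing along
   q(s) - 1 = (p - 1) e^(2s);
   complex f reduce to |f| because the kernel of P_t is nonnegative.

   For the log-Sobolev inequality normalise ||f||_2 = 1, let a be the mean of f
   and g = f - a. From x^2 ln x^2 <= 2/3 x^3 + x^2 - 2 x + 1/3 it suffices to
   control the mean of g^3 = sum of g_a g_b g_c over a + b + c = 0 in Z_n. By
   the symmetry k |-> -k this is twice the sum over a + b + c = n in nat; giving
   each triple to its largest entry c, fewer than psi c triples go to each c,
   and 4 xyz <= 2 z^2 + 2 x^2 y^2 bounds it by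
   2 sum (psi k - 1)|g_k|^2 + 1/2 (sum |g_k|^2)^2. What remains is
   (a - 1)^3 (3 a + 1) <= 0.

   Necessity is the second-order expansion at the constant 1 along
   cos (2 pi x / n). *)
Require Import Defs.
From mathcomp Require Import all_boot all_order all_algebra.
From mathcomp Require Import boolp classical_sets functions topology normedtype.
From mathcomp Require Import reals derive realfun sequences exp trigo complex.
From mathcomp Require Import ring lra zify.

Set Implicit Arguments.
Unset Strict Implicit.
Unset Printing Implicit Defensive.

Import Order.TTheory GRing.Theory Num.Theory.
Import numFieldNormedType.Exports.
Local Open Scope ring_scope.
Local Open Scope complex_scope.

(** * Sums over triples in Z_n *)

Lemma ltn_Zp (m : nat) (k : 'Z_m.+2) : (k < m.+2)%N.
Proof. exact: ltn_ord. Qed.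

Lemma Zp_gt0 (m : nat) (k : 'Z_m.+2) : (0 < k)%N = (k != 0).
Proof. by rewrite -val_eqE lt0n. Qed.

Lemma val_oppZ (m : nat) (k : 'Z_m.+2) :
  k != 0 -> (- k : 'Z_m.+2) = (m.+2 - k)%N :> nat.
Proof.
rewrite -val_eqE -lt0n => k0.
change (((m.+2 - k) %% m.+2)%N = (m.+2 - k)%N).
by rewrite modn_small // ltn_subrL k0.
Qed.

Lemma wordlenN (m : nat) (k : 'Z_m.+2) : wordlen (- k) = wordlen k.
Proof.
have [->|k0] := eqVneq k 0; first by rewrite oppr0.
by rewrite /wordlen val_oppZ //; have := ltn_Zp k; lia.
Qed.

Section cubic_bound.
Variables (R : realFieldType) (m : nat).
Local Notation n := m.+2.
Variable G : 'Z_n -> R.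
Hypotheses (G_ge0 : forall k, 0 <= G k) (G0 : G 0 = 0).
Hypothesis GN : forall k : 'Z_n, G (- k) = G k.

Let G_eq0 (a : 'Z_n) : (a : nat) = 0%N -> G a = 0.
Proof. by move=> a0; rewrite -[RHS]G0; congr G; apply: val_inj. Qed.

(** Since [G] is even, [G (a + b)] equals [G c] for the c with a + b + c = 0 in Z_n. The
    representatives of such a triple add up to n or 2n, and k |-> -k exchanges the two cases;
    triples with a zero entry contribute nothing. *)
Lemma sum_triples_Zp :
  \sum_(a : 'Z_n) \sum_(b : 'Z_n) G a * G b * G (a + b) =
  2 * \sum_(a : 'Z_n) \sum_(b : 'Z_n) \sum_(c : 'Z_n)
    (a + b + c == n)%N%:R * (G a * G b * G c).
Proof.
have E a b : G a * G b * G (a + b) =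
    \sum_(c : 'Z_n) (a + b + c == n)%N%:R * (G a * G b * G c) +
    \sum_(c : 'Z_n) (a + b + c == n.*2)%N%:R * (G a * G b * G c).
  rewrite -big_split /= -[G (a + b)]GN.
  have -> : G (- (a + b)) = \sum_(c | c == - (a + b)) G c.
    by rewrite big_pred1_eq.
  rewrite mulr_sumr big_mkcond /=; apply: eq_bigr => c _.
  have [a0|a0] := posnP a.
    by rewrite (G_eq0 a0) !(mul0r, mulr0, addr0) if_same.
  rewrite -mulrDl.
  have -> : (c == - (a + b)) = (n %| a + b + c)%N.
    by rewrite -addr_eq0 addrC -val_eqE /= modnDml.
  have ha := ltn_Zp a; have hb := ltn_Zp b; have hc := ltn_Zp c.
  case: ifPn => [/dvdnP[j hj]|hj].
    have j12 : j = 1%N \/ j = 2%N.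
      have : (0 < j)%N by move: hj; case: (j) => //; lia.
      have : (j < 3)%N by rewrite -(ltn_pmul2r (isT : (0 < n)%N)) -hj; lia.
      lia.
    case: j12 hj => -> hj.
    - rewrite hj mul1n eqxx; have -> : (n == n.*2) = false by lia.
      by rewrite addr0 mul1r.
    - rewrite hj; have -> : (2 * n == n)%N = false by lia.
      by rewrite mul2n eqxx add0r mul1r.
  have -> : (a + b + c == n)%N = false.
    by apply: contraNF hj => /eqP ->; apply: dvdnn.
  have -> : (a + b + c == n.*2)%N = false.
    by apply: contraNF hj => /eqP ->; rewrite -mul2n dvdn_mull.
  by rewrite addr0 mul0r.
transitivity (\sum_(a : 'Z_n) \sum_(b : 'Z_n) \sum_(c : 'Z_n)
  (a + b + c == n)%N%:R * (G a * G b * G c) +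
   \sum_(a : 'Z_n) \sum_(b : 'Z_n) \sum_(c : 'Z_n)
     (a + b + c == n.*2)%N%:R * (G a * G b * G c)).
  rewrite -big_split; apply: eq_bigr => a _; rewrite -big_split.
  by apply: eq_bigr => b _; rewrite E.
rewrite mulr_natl mulr2n; congr (_ + _).
rewrite (reindex_inj oppr_inj); apply: eq_bigr => a _.
rewrite (reindex_inj oppr_inj); apply: eq_bigr => b _.
rewrite (reindex_inj oppr_inj); apply: eq_bigr => c _.
rewrite !GN.
have [-> | a0] := eqVneq a 0; first by rewrite G0 !(mul0r, mulr0).
have [-> | b0] := eqVneq b 0; first by rewrite G0 !(mul0r, mulr0).
have [-> | c0] := eqVneq c 0; first by rewrite G0 !(mul0r, mulr0).
rewrite !val_oppZ //; congr (_%:R * _); congr nat_of_bool.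
move: a0 b0 c0 (ltn_Zp a) (ltn_Zp b) (ltn_Zp c); rewrite -!val_eqE /=; lia.
Qed.

(* The largest entry of a triple is taken as c; the tie-break keeps the number
   of pairs (a, b) that go with a given c below wordlen c. *)
Let sel (a b c : nat) :=
  (a + b + c == n)%N && ((a <= c) && (b < c) || (a == c) && (b == c))%N.

Let sum_rot (F : 'Z_n -> 'Z_n -> 'Z_n -> R) :
  \sum_(a : 'Z_n) \sum_(b : 'Z_n) \sum_(c : 'Z_n) F a b c =
  \sum_(a : 'Z_n) \sum_(b : 'Z_n) \sum_(c : 'Z_n) F b c a.
Proof.
rewrite exchange_big [RHS]exchange_big /=.
rewrite [RHS](eq_bigr (fun b => \sum_(c : 'Z_n)
  \sum_(a : 'Z_n) F b c a)); last first.
  by move=> b _; rewrite exchange_big.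
by rewrite exchange_big.
Qed.

(** Some cyclic rotation of every triple of sum n is selected by [sel], and rotations do not change
    the product. *)
Lemma sum_triples_sel :
  \sum_(a : 'Z_n) \sum_(b : 'Z_n) \sum_(c : 'Z_n)
    (a + b + c == n)%N%:R * (G a * G b * G c) <=
  3 * \sum_(a : 'Z_n) \sum_(b : 'Z_n) \sum_(c : 'Z_n)
    (sel a b c)%:R * (G a * G b * G c).
Proof.
have some_rot (x y z : nat) :
    ((x + y + z == n) <= sel x y z + sel y z x + sel z x y)%N.
  rewrite /sel; lia.
set X := \sum_(a : 'Z_n) \sum_(b : 'Z_n) \sum_(c : 'Z_n) (sel a b c)%:R * _.
have E1 : X = \sum_(a : 'Z_n) \sum_(b : 'Z_n) \sum_(c : 'Z_n)
  (sel b c a)%:R * (G a * G b * G c).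
  rewrite /X sum_rot; apply: eq_bigr => a _; apply: eq_bigr => b _.
  by apply: eq_bigr => c _; congr (_ * _); ring.
have E2 : X = \sum_(a : 'Z_n) \sum_(b : 'Z_n) \sum_(c : 'Z_n)
  (sel c a b)%:R * (G a * G b * G c).
  rewrite E1 sum_rot; apply: eq_bigr => a _; apply: eq_bigr => b _.
  by apply: eq_bigr => c _; congr (_ * _); ring.
have -> : 3 * X = X + X + X by ring.
rewrite {2}E1 {2}E2 /X -!big_split /=; apply: ler_sum => a _.
rewrite -!big_split /=; apply: ler_sum => b _.
rewrite -!big_split /=; apply: ler_sum => c _.
by rewrite -!mulrDl ler_wpM2r ?mulr_ge0 // -!natrD ler_nat.
Qed.

Let card_lt (k j : nat) :
  (\sum_(i < k) ((0 < i) && (i < j)) <= j.-1)%N.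
Proof.
suff : (\sum_(i < k) ((0 < i) && (i < j)) <= (minn k j).-1)%N by lia.
elim: k => [|k IH]; first by rewrite big_ord0.
rewrite big_ord_recr /=; apply: leq_trans (leq_add IH (leqnn _)) _; lia.
Qed.

Let sum_eq_le1 (k j : nat) : (\sum_(i < k) (i == j :> nat) <= 1)%N.
Proof.
elim: k => [|k IH]; first by rewrite big_ord0.
rewrite big_ord_recr /=; case: eqP => [<-|]; last by rewrite addn0.
by rewrite big1 // => i _; rewrite (ltn_eqF (ltn_ord i)).
Qed.

(** Given c, the entry b determines a. Unless 3c = n, selection forces b < c and a > 0 forces b < n
    - c, which leaves at most [(wordlen c).-1] values of b. If 3c = n, only a = b = c remains, and
    this one triple fits because n >= 4 gives c >= 2. *)
Let card_sel (c : 'Z_n) : (4 <= n)%N -> (0 < c)%N ->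
  (\sum_(a : 'Z_n) \sum_(b : 'Z_n) [&& sel a b c, 0 < a & 0 < b] <=
    (wordlen c).-1)%N.
Proof.
move=> n4 c0; have hc := ltn_Zp c.
have [c3|c3] := eqVneq (3 * c)%N n.
  apply: (@leq_trans (\sum_(a : 'Z_n) \sum_(b : 'Z_n)
    (b == c :> nat) * (a == c :> nat))).
    apply: leq_sum => a _; apply: leq_sum => b _; rewrite /sel; lia.
  rewrite (eq_bigr (fun a : 'Z_n => (\sum_(b : 'Z_n)
    (b == c :> nat)) * (a == c :> nat)))%N; last first.
    by move=> a _; rewrite big_distrl.
  rewrite -big_distrr /=.
  apply: (@leq_trans (1 * 1)); first by apply: leq_mul; apply: sum_eq_le1.
  rewrite /wordlen; lia.
rewrite exchange_big /=.
apply: leq_trans (card_lt n (wordlen c)).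
apply: leq_sum => b _.
have [hb|hb] := boolP ((0 < b) && (b < wordlen c))%N; last first.
  rewrite big1 // => a _; apply/eqP; rewrite eqb0; apply: contra hb;
    rewrite /sel /wordlen.
  move: c3; lia.
apply: leq_trans (sum_eq_le1 n (n - b - c)).
apply: leq_sum => a _; rewrite /sel.
move: (nat_of_ord a) (nat_of_ord b) (nat_of_ord c); clear => x y z; lia.
Qed.

(** For k != 0 at most one of k and -k lies below n/2, and [G] takes the same value at both. *)
Let sum_low_half : 2 * \sum_(a : 'Z_n) (a.*2 < n)%N%:R * G a ^+ 2 <=
  \sum_(a : 'Z_n) G a ^+ 2.
Proof.
rewrite mulr_natl mulr2n {2}(reindex_inj oppr_inj) -big_split.
apply: ler_sum => a _; rewrite GN.
have [-> | a0] := eqVneq a 0; first by rewrite G0 expr0n /= !mulr0 addr0.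
rewrite val_oppZ //= -mulrDl ler_piMl ?sqr_ge0 // -natrD (ler_nat R _ 1).
move: a0 (ltn_Zp a); rewrite -val_eqE /=; lia.
Qed.

Lemma cubic_bound : (4 <= n)%N ->
  2 / 3 * \sum_(a : 'Z_n) \sum_(b : 'Z_n) G a * G b * G (a + b) <=
  2 * \sum_k ((wordlen k)%:R - 1) * G k ^+ 2 + 2^-1 * (\sum_k G k ^+ 2) ^+ 2.
Proof.
move=> n4; rewrite sum_triples_Zp.
(* The factor 4 is 2/3 * 2 * 3. *)
apply: (@le_trans _ _ (4 * \sum_(a : 'Z_n) \sum_(b : 'Z_n) \sum_(c : 'Z_n)
  (sel a b c)%:R * (G a * G b * G c))).
  have := sum_triples_sel; lra.
pose s (a b c : 'Z_n) := [&& sel a b c, 0 < a & 0 < b]%N.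
apply: (@le_trans _ _ (\sum_(a : 'Z_n) \sum_(b : 'Z_n) \sum_(c : 'Z_n)
  (2 * ((s a b c)%:R * G c ^+ 2) +
    2 * ((s a b c)%:R * (G a ^+ 2 * G b ^+ 2))))).
  rewrite mulr_sumr; apply: ler_sum => a _; rewrite mulr_sumr;
    apply: ler_sum => b _.
  rewrite mulr_sumr; apply: ler_sum => c _.
  have [a0|a0] := posnP a; first by rewrite /s /= a0 !andbF (G_eq0 a0)
    !(mul0r, mulr0) addr0.
  have [b0|b0] := posnP b; first by rewrite /s /= b0 !andbF (G_eq0 b0)
    !(mul0r, mulr0) addr0.
  rewrite /s a0 b0 !andbT; case: (sel _ _ _);
    rewrite ?mul0r ?mulr0 ?addr0 // !mul1r.
  have := sqr_ge0 (G c - G a * G b); nra.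
have -> : forall F1 F2 : 'Z_n -> 'Z_n -> 'Z_n -> R,
  \sum_(a : 'Z_n) \sum_(b : 'Z_n) \sum_(c : 'Z_n)
    (2 * F1 a b c + 2 * F2 a b c) =
  2 * (\sum_(a : 'Z_n) \sum_(b : 'Z_n) \sum_(c : 'Z_n) F1 a b c) +
  2 * (\sum_(a : 'Z_n) \sum_(b : 'Z_n) \sum_(c : 'Z_n) F2 a b c).
  move=> F1 F2; rewrite !mulr_sumr -big_split; apply: eq_bigr => a _.
  rewrite !mulr_sumr -big_split; apply: eq_bigr => b _.
  by rewrite !mulr_sumr -big_split; apply: eq_bigr => c _.
apply: lerD.
  (* By [card_sel], [G c ^+ 2] is counted at most [wordlen c - 1] times. *)
  rewrite ler_pM2l // sum_rot; apply: ler_sum => c _.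
  have [c0|c0] := posnP c.
    rewrite (G_eq0 c0) expr0n /= mulr0 big1 // => a _; rewrite big1 // => b _.
    by rewrite mulr0.
  under eq_bigr => a _ do rewrite -mulr_suml.
  rewrite -mulr_suml ler_wpM2r ?sqr_ge0 //.
  under eq_bigr => a _ do rewrite -natr_sum.
  rewrite -natr_sum.
  have -> : (wordlen c)%:R - 1 = (wordlen c).-1%:R :> R.
    have w0 : (0 < wordlen c)%N by have := ltn_Zp c; rewrite /wordlen; lia.
    by rewrite -[X in X%:R - 1](prednK w0) -natr1 addrK.
  by rewrite ler_nat; apply: card_sel.
(* In a selected triple with a, b > 0 both a and b are below n/2, and they determine c. By
   [sum_low_half] the restricted sum is at most half the full one, so squaring gains 1/4. *)
apply: (@le_trans _ _ (2 * (\sum_(a : 'Z_n) (a.*2 < n)%N%:R *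
  G a ^+ 2) ^+ 2)); last first.
  have h0 : 0 <= \sum_(a : 'Z_n) (a.*2 < n)%N%:R * G a ^+ 2.
    by apply: sumr_ge0 => a _; rewrite mulr_ge0 ?sqr_ge0 ?ler0n.
  have aux (x y : R) : 0 <= x -> 2 * x <= y -> 2 * x ^+ 2 <= 2^-1 * y ^+ 2.
    by move=> x0 xy; nra.
  exact: aux h0 sum_low_half.
rewrite ler_pM2l // expr2 mulr_suml; apply: ler_sum => a _.
rewrite mulr_sumr; apply: ler_sum => b _.
rewrite -mulr_suml -natr_sum.
rewrite [leRHS](_ : _ = ((a.*2 < n) * (b.*2 < n))%N%:R * (G a ^+ 2 *
  G b ^+ 2)); last first.
  by rewrite natrM; ring.
rewrite ler_wpM2r ?mulr_ge0 ?sqr_ge0 // ler_nat.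
have [hab|hab] := boolP ((a.*2 < n) && (b.*2 < n))%N; last first.
  rewrite big1 // => c _; apply/eqP; rewrite eqb0; apply: contra hab;
    rewrite /s /sel; lia.
case/andP: hab => -> ->; apply: leq_trans (sum_eq_le1 n (n - a - b)).
apply: leq_sum => c _; rewrite /s /sel.
move: (nat_of_ord a) (nat_of_ord b) (nat_of_ord c); clear => x y z; lia.
Qed.
End cubic_bound.

(** * Fourier multipliers on Z_n *)

Lemma chi_cis (R : realType) (n : nat) (k x : 'Z_n) :
  chi R k x = cis (2 * pi * (k * x)%N%:R / n%:R).
Proof. by []. Qed.

Section characters.
Variables (R : realType) (m : nat).
Local Notation n := m.+2.
Local Opaque chi.
Implicit Types (f g : 'Z_n -> R) (F : 'Z_n -> R[i]) (phi psi : nat -> R).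

Definition mean f : R := n%:R^-1 * \sum_x f x.

(** The inverse Fourier transform of k |-> [phi (wordlen k)]. This symbol is even, so the transform
    is real and the real part loses nothing. *)
Definition cosine_kernel phi (x : 'Z_n) : R :=
  n%:R^-1 * \sum_(k : 'Z_n) phi (wordlen k) * complex.Re (chi R k x).

Definition multiplier phi f (x : 'Z_n) : R :=
  \sum_(y : 'Z_n) cosine_kernel phi (x - y) * f y.

Local Notation fhat f := (@fourier_coef R n (fun x => (f x)%:C)).

Let n1 : (1 < n)%N. Proof. by []. Qed.

Lemma chi0 (k : 'Z_n) : chi R k 0 = 1.
Proof. by rewrite chiE muln0 expr0. Qed.

(** [x + y] is reduced modulo n while [chi] multiplies in nat; the two agree because the underlying
    root of unity has n-th power 1. *)
Lemma chiD (k x y : 'Z_n) : chi R k (x + y) = chi R k x * chi R k y.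
Proof.
have wn : (cis (2 * pi / n%:R) : R[i]) ^+ n = 1.
  by rewrite -cisM divfK ?pnatr_eq0 // mulrC /cis mulr_natr cos2pi sin2pi.
rewrite !chiE -exprD -mulnDr !exprM.
by apply: (@expr_mod _ n); rewrite -exprM mulnC exprM wn expr1n.
Qed.

Lemma chiMJ (k x : 'Z_n) : chi R k x * conjc (chi R k x) = 1.
Proof. by rewrite chi_cis conj_cis -cisD subrr cis0. Qed.

Lemma chiN (k x : 'Z_n) : chi R k (- x) = conjc (chi R k x).
Proof.
by rewrite -[RHS]mul1r -(chi0 k) -(addNr x) chiD -mulrA chiMJ mulr1.
Qed.

Lemma chiNl (k x : 'Z_n) : chi R (- k) x = conjc (chi R k x).
Proof. by rewrite chiC chiN chiC. Qed.

Lemma chiDl (k j x : 'Z_n) : chi R (k + j) x = chi R k x * chi R j x.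
Proof. by rewrite chiC chiD !(chiC _ x). Qed.

Lemma conjcM (z w : R[i]) : conjc (z * w) = conjc z * conjc w.
Proof. exact: rmorphM. Qed.

Lemma mulcJ (z : R[i]) : z * conjc z = (Normc.normc z ^+ 2)%:C.
Proof.
case: z => a b; rewrite /= sqr_sqrtr ?addr_ge0 ?sqr_ge0 //; simpc.
by congr (_ +i* _); ring.
Qed.

Lemma normc_ge0 (z : R[i]) : 0 <= Normc.normc z.
Proof. by case: z => a b; exact: sqrtr_ge0. Qed.

Lemma normc_conj (z : R[i]) : Normc.normc (conjc z) = Normc.normc z.
Proof. by case: z => a b; rewrite /= sqrrN. Qed.

Lemma normc_real (x : R) : Normc.normc x%:C = `|x|.
Proof. by rewrite /= expr0n /= addr0 sqrtr_sqr. Qed.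

Lemma ler_normc_sum (I : finType) (h : I -> R[i]) :
  Normc.normc (\sum_i h i) <= \sum_i Normc.normc (h i).
Proof.
elim/big_ind2: _ => [|x1 x2 y1 y2 h1 h2|//]; first by rewrite Normc.normc0.
exact: le_trans (le_normcD _ _) (lerD h1 h2).
Qed.

Lemma cosine_kernelC phi (z : 'Z_n) :
  (cosine_kernel phi z)%:C =
  n%:R^-1 * \sum_(k : 'Z_n) (phi (wordlen k))%:C * chi R k z.
Proof.
have E : \sum_(k : 'Z_n) (phi (wordlen k))%:C * conjc (chi R k z) =
         \sum_(k : 'Z_n) (phi (wordlen k))%:C * chi R k z.
  rewrite (reindex_inj oppr_inj); apply: eq_bigr => k _.
  by rewrite wordlenN chiNl conjcK.
rewrite /cosine_kernel rmorphM /= fmorphV rmorph_nat; congr (_ * _).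
rewrite rmorph_sum /=.
transitivity (2^-1 * (\sum_(k : 'Z_n) (phi (wordlen k))%:C * chi R k z +
    \sum_(k : 'Z_n) (phi (wordlen k))%:C * conjc (chi R k z))).
  rewrite -big_split mulr_sumr; apply: eq_bigr => k _;
    move: (chi R k z) => w /=.
  by rewrite rmorphM /= ReJ_add; ring.
by rewrite E; field.
Qed.

Lemma eq_fourier_coef F1 F2 (k : 'Z_n) :
  F1 =1 F2 -> fourier_coef F1 k = fourier_coef F2 k.
Proof.
by move=> E; congr (_ * _); apply: eq_bigr => x _; rewrite E.
Qed.

(** The convolution theorem; it turns [poisson_semigroup] into convolution with a real kernel. *)
Lemma sum_fourier_multiplier phi F (x : 'Z_n) :
  \sum_(k : 'Z_n) (phi (wordlen k))%:C * fourier_coef F k * chi R k x =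
  \sum_(y : 'Z_n) (cosine_kernel phi (x - y))%:C * F y.
Proof.
under [RHS]eq_bigr => y _ do rewrite cosine_kernelC -mulrA mulr_suml.
rewrite -mulr_sumr exchange_big mulr_sumr; apply: eq_bigr => k _ /=.
rewrite /fourier_coef [LHS]mulrC !mulr_sumr; apply: eq_bigr => y _.
by rewrite chiD chiN; ring.
Qed.

Lemma multiplierC phi f (x : 'Z_n) :
  (multiplier phi f x)%:C =
  \sum_(k : 'Z_n) (phi (wordlen k))%:C * fhat f k * chi R k x.
Proof.
rewrite sum_fourier_multiplier rmorph_sum.
by apply: eq_bigr => y _; rewrite rmorphM.
Qed.

Lemma fourier_multiplier phi f (k : 'Z_n) :
  fhat (multiplier phi f) k = (phi (wordlen k))%:C * fhat f k.
Proof.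
rewrite (eq_fourier_coef _ (multiplierC phi f)).
by rewrite (fourier_coef_sum n1 (fun k => (phi (wordlen k))%:C * fhat f k)).
Qed.

Lemma multiplier_comp phi psi f (x : 'Z_n) :
  multiplier phi (multiplier psi f) x =
  multiplier (fun k => phi k * psi k) f x.
Proof.
apply: complexI; rewrite !multiplierC; apply: eq_bigr => k _.
by rewrite fourier_multiplier rmorphM mulrA.
Qed.

Lemma multiplier1 f (x : 'Z_n) : multiplier (fun=> 1) f x = f x.
Proof.
apply: complexI; rewrite multiplierC [RHS](fourier_inversion n1 (fun x => (f
  x)%:C)).
by apply: eq_bigr => k _; rewrite mul1r.
Qed.

Lemma parseval F1 F2 :
  n%:R^-1 * \sum_(x : 'Z_n) F1 x * conjc (F2 x) =
  \sum_(k : 'Z_n) fourier_coef F1 k * conjc (fourier_coef F2 k).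
Proof.
under [in LHS]eq_bigr => x _ do rewrite (fourier_inversion n1 F1 x) mulr_suml.
rewrite exchange_big mulr_sumr; apply: eq_bigr => k _ /=.
rewrite /fourier_coef !(rmorphM, rmorph_sum) /= fmorphV rmorph_nat /=.
rewrite !mulr_sumr; apply: eq_bigr => x _.
by rewrite rmorphM /= conjcK -/(fourier_coef F1 k); ring.
Qed.

Lemma meanC f : (mean f)%:C = n%:R^-1 * \sum_(x : 'Z_n) (f x)%:C.
Proof. by rewrite /mean rmorphM fmorphV /= rmorph_nat rmorph_sum. Qed.

Lemma mean_multiplier phi f :
  mean (fun x => f x * multiplier phi f x) =
  \sum_(k : 'Z_n) phi (wordlen k) * Normc.normc (fhat f k) ^+ 2.
Proof.
apply: complexI; rewrite meanC rmorph_sum /=.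
transitivity (n%:R^-1 * \sum_(x : 'Z_n) (multiplier phi f x)%:C *
  conjc (f x)%:C).
  by congr (_ * _); apply: eq_bigr => x _; rewrite conjc_real rmorphM mulrC.
rewrite (parseval (fun x => (multiplier phi f x)%:C) (fun x => (f x)%:C)).
by apply: eq_bigr => k _; rewrite fourier_multiplier -mulrA mulcJ -rmorphM.
Qed.

Lemma mean_sqr f : mean (fun x => f x ^+ 2) =
  \sum_(k : 'Z_n) Normc.normc (fhat f k) ^+ 2.
Proof.
under [RHS]eq_bigr => k _ do rewrite -[_ ^+ 2]mul1r.
rewrite -(mean_multiplier (fun=> 1)); congr (_ * _).
by apply: eq_bigr => x _; rewrite multiplier1 expr2.
Qed.

Lemma fourier_coef0 f : fhat f 0 = (mean f)%:C.
Proof.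
rewrite meanC; congr (_ * _); apply: eq_bigr => x _.
by rewrite chiC chi0 conjc1 mulr1.
Qed.

Lemma fourier_coefN f (k : 'Z_n) : fhat f (- k) = conjc (fhat f k).
Proof.
rewrite /fourier_coef rmorphM fmorphV rmorph_nat rmorph_sum; congr (_ * _).
apply: eq_bigr => x _; rewrite chiNl; symmetry; apply: etrans (conjcM _ _) _.
by rewrite conjc_real.
Qed.

Lemma fourier_subC f (a : R) (k : 'Z_n) : k != 0 ->
  fhat (fun x => f x - a) k = fhat f k.
Proof.
move=> k0; congr (_ * _).
have E : \sum_(x : 'Z_n) conjc (chi R k x) = 0.
  have := chi_orth R n1 0 k; rewrite eq_sym (negbTE k0) mulr0n => O.
  rewrite -[RHS]O.
  by apply: eq_bigr => x _; rewrite [chi R 0 x]chiC chi0 mul1r.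
under eq_bigr => x _ do rewrite rmorphB mulrBl.
by rewrite sumrB -mulr_sumr E mulr0 subr0.
Qed.

(** Expanding two of the three factors in characters leaves, from the third, the conjugate
    coefficient at a + b; then the triangle inequality applies. *)
Lemma mean_cube_le f :
  mean (fun x => f x ^+ 3) <=
  \sum_(a : 'Z_n) \sum_(b : 'Z_n)
    Normc.normc (fhat f a) * Normc.normc (fhat f b) *
    Normc.normc (fhat f (a + b)).
Proof.
have E : (mean (fun x => f x ^+ 3))%:C =
  \sum_(a : 'Z_n) \sum_(b : 'Z_n) fhat f a * fhat f b * conjc (fhat f (a + b)).
  rewrite meanC.
  transitivity (n%:R^-1 * \sum_(x : 'Z_n) \sum_(a : 'Z_n) \sum_(b : 'Z_n)
     fhat f a * fhat f b * (chi R (a + b) x * (f x)%:C)).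
    congr (_ * _); apply: eq_bigr => x _.
    rewrite !exprS expr0 mulr1 !rmorphM /= mulrA.
    have FI := fourier_inversion n1 (fun x => (f x)%:C) x.
    rewrite [X in X * _ * _]FI mulr_suml mulr_suml.
    apply: eq_bigr => a _.
    rewrite [X in _ * X * _]FI mulr_sumr mulr_suml.
    by apply: eq_bigr => b _; rewrite chiDl; ring.
  rewrite exchange_big mulr_sumr; apply: eq_bigr => a _ /=.
  rewrite exchange_big mulr_sumr; apply: eq_bigr => b _ /=.
  rewrite -mulr_sumr mulrCA; congr (_ * _).
  rewrite [in RHS]/fourier_coef rmorphM fmorphV rmorph_nat rmorph_sum;
    congr (_ * _).
  apply: eq_bigr => x _; symmetry; apply: etrans (conjcM _ _) _.
  by rewrite conjcK conjc_real mulrC.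
apply: le_trans (ler_norm _) _; rewrite -normc_real E.
apply: le_trans (ler_normc_sum _) _; apply: ler_sum => a _.
apply: le_trans (ler_normc_sum _) _; apply: ler_sum => b _.
by rewrite Normc.normcM normc_conj Normc.normcM.
Qed.

(** * Signs of the convolution kernels and the Dirichlet form *)

Lemma normc_chi (k x : 'Z_n) : Normc.normc (chi R k x) = 1.
Proof.
by apply/eqP; rewrite -(@eqrXn2 _ 2) ?normc_ge0 // expr1n; apply/eqP/complexI;
  rewrite -mulcJ chiMJ.
Qed.

(** A number of modulus one other than 1 has real part below 1. Strictness makes the factor
    [2 * c 1 - 2] in [cosine_kernel_ge0] negative. *)
Lemma Re_chi1_lt1 (z : 'Z_n) : z != 0 -> complex.Re (chi R 1 z) < 1.
Proof.
move=> z0; rewrite lt_neqAle {2}chi_cis cos_le1 andbT.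
have : chi R 1 z != 1.
  rewrite chi_cis cis_neq1 //; have zn := ltn_Zp z.
  have : (0 < z)%N by rewrite Zp_gt0.
  have -> : (nat_of_ord (1%R : 'Z_n) * z)%N = z by rewrite mul1n.
  move=> z_gt0; rewrite divr_gt0 ?mulr_gt0 ?pi_gt0 ?ltr0n //=.
  by rewrite ltr_pdivrMr ?ltr0n // ltr_pM2l ?ltr_nat // mulr_gt0 ?pi_gt0.
apply: contra; have := mulcJ (chi R 1 z).
rewrite normc_chi expr1n chi_cis /cis /= => -[h _] /eqP c1.
move: h; rewrite c1 mulr1 -[RHS]addr0 mulrN opprK => /addrI /eqP.
by rewrite mulf_eq0 orbb => /eqP ->.
Qed.

(* Convexity away from 0 makes the Fourier transform nonnegative: two summations
   by parts multiply it by 2 cos - 2 and give sum_k D k (cos - 1), D >= 0 being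
   the second difference. *)
Lemma cosine_kernel_ge0 phi (z : 'Z_n) :
  (forall k : 'Z_n, k != 0 ->
     2 * phi (wordlen k) <= phi (wordlen (k + 1)) + phi (wordlen (k - 1))) ->
  z != 0 -> 0 <= cosine_kernel phi z.
Proof.
move=> conv z0; rewrite mulr_ge0 ?invr_ge0 ?ler0n //.
pose c (k : 'Z_n) := complex.Re (chi R k z);
  pose p (k : 'Z_n) := phi (wordlen k).
rewrite -/(\sum_(k : 'Z_n) p k * c k).
have cc k : c (k + 1) + c (k - 1) = 2 * c 1 * c k.
  rewrite /c !chiDl chiNl; case: (chi R k z) => a b;
    case: (chi R 1 z) => a' b' /=.
  by ring.
have shift (h : 'Z_n -> R) (j : 'Z_n) : \sum_k h (k + j) = \sum_k h k.
  by rewrite [RHS](reindex_inj (addIr j)).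
pose D k := p (k + 1) + p (k - 1) - 2 * p k.
have D0 : \sum_k D k = 0.
  by rewrite sumrB big_split /= !shift -mulr_sumr; ring.
have Dc : \sum_k D k * c k = (2 * c 1 - 2) * \sum_k p k * c k.
  transitivity (\sum_k p (k + 1) * c k + \sum_k p (k - 1) * c k - 2 *
    \sum_k p k * c k).
    by rewrite mulr_sumr -big_split -sumrB; apply: eq_bigr => k _;
      rewrite /D /=; ring.
  rewrite -(shift (fun k => p (k + 1) * c k) (-1)) -(shift (fun k => p (k - 1)
    * c k) 1).
  rewrite -big_split mulrBl [2 * c 1 * _]mulr_sumr; congr (_ - _);
    apply: eq_bigr => k _ /=.
  by rewrite subrK addrK -mulrDr [c _ + _]addrC cc; ring.
have : \sum_k D k * c k <= 0.
  (* [D] sums to 0, so cos may be replaced by cos - 1 <= 0. The term k = 0, where convexity is not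
     assumed, vanishes because [c 0] is 1. *)
  have -> : \sum_k D k * c k = \sum_k (D k * c k - D k).
    by rewrite sumrB D0 subr0.
  apply: sumr_le0 => k _.
  rewrite -[X in _ - X]mulr1 -mulrBr.
  have [-> | k0] := eqVneq k 0; first by rewrite /c chiC chi0 /= subrr mulr0.
  by rewrite mulr_ge0_le0 ?subr_ge0 ?conv // subr_le0 /c chi_cis cos_le1.
rewrite Dc; have := Re_chi1_lt1 z0; rewrite -/(c 1) => c1.
rewrite nmulr_rle0 //; lra.
Qed.

Lemma sum_cosine_kernel phi (x : 'Z_n) :
  \sum_(y : 'Z_n) cosine_kernel phi (x - y) = phi 0%N.
Proof.
apply: complexI; have := multiplierC phi (fun=> 1) x; rewrite /multiplier.
under eq_bigr => y _ do rewrite mulr1.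
move=> ->; rewrite (bigD1 0) //= big1 ?addr0 => [|k k0].
  rewrite fourier_coef0 chiC chi0 mulr1 /mean sumr_const card_ord.
  by rewrite mulVf ?pnatr_eq0 // mulr1 /wordlen min0n.
have := @fourier_subC (fun=> 1) 1 _ k0; rewrite subrr => <-.
by rewrite /fourier_coef big1 ?mulr0 ?mul0r // => y _; rewrite mul0r.
Qed.

Lemma cosine_kernelN phi (x : 'Z_n) :
  cosine_kernel phi (- x) = cosine_kernel phi x.
Proof.
by congr (_ * _); apply: eq_bigr => k _; rewrite chiN; case: (chi R k x).
Qed.

(** As phi vanishes at 0, the kernel has zero row sums, so the form can be completed to differences.
    Then only off-diagonal kernel entries matter, and their sign can be used term by term. *)
Lemma mean_multiplier_diff phi f g : phi 0%N = 0 ->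
  mean (fun x => g x * multiplier phi f x) =
  - (2 * n%:R)^-1 * \sum_(x : 'Z_n) \sum_(y : 'Z_n)
     cosine_kernel phi (x - y) * ((f x - f y) * (g x - g y)).
Proof.
move=> phi0; pose K x y := cosine_kernel phi (x - y).
have KC x y : K x y = K y x by rewrite /K -cosine_kernelN opprB.
pose A := \sum_x \sum_y K x y * (f y * g x).
have -> : mean (fun x => g x * multiplier phi f x) = n%:R^-1 * A.
  congr (_ * _); apply: eq_bigr => x _; rewrite mulr_sumr.
  by apply: eq_bigr => y _; rewrite /K; ring.
have A' : \sum_x \sum_y K x y * (f x * g y) = A.
  by rewrite exchange_big; apply: eq_bigr => x _; apply: eq_bigr => y _;
    rewrite KC.
have diag (h : 'Z_n -> R) : \sum_x \sum_y K x y * h x = 0.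
  by rewrite big1 // => x _; rewrite -mulr_suml sum_cosine_kernel phi0 mul0r.
have diag' (h : 'Z_n -> R) : \sum_x \sum_y K x y * h y = 0.
  rewrite -[RHS](diag h) exchange_big.
  by apply: eq_bigr => x _; apply: eq_bigr => y _; rewrite KC.
have -> : \sum_x \sum_y cosine_kernel phi (x - y) * ((f x - f y) *
  (g x - g y)) =
  \sum_x \sum_y K x y * (f x * g x) + \sum_x \sum_y K x y * (f y * g y)
   - \sum_x \sum_y K x y * (f x * g y) - A.
  rewrite /A -big_split -!sumrB; apply: eq_bigr => x _ /=.
  rewrite -big_split -!sumrB; apply: eq_bigr => y _ /=; rewrite /K; ring.
rewrite (diag (fun x => f x * g x)) (diag' (fun x => f x * g x)) A'.
by field; rewrite -natrD pnatr_eq0.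
Qed.

(** Cutting the cycle at 0 reduces this to min (k, n - k) on integers. The one-step bounds leave few
    cases for the neighbours in [cosine_kernel_exp_ge0]. *)
Lemma wordlen_concave (k : 'Z_n) : k != 0 ->
  [/\ (wordlen (k + 1)%R + wordlen (k - 1)%R <= 2 * wordlen k)%N,
      (wordlen k <= (wordlen (k + 1)%R).+1)%N &
      (wordlen k <= (wordlen (k - 1)%R).+1)%N].
Proof.
move=> k0; have kn := ltn_Zp k.
have k_gt0 : (0 < k)%N by rewrite Zp_gt0.
have vS : wordlen (k + 1) = minn k.+1 (n - k.+1).
  have vk : nat_of_ord (k + 1) = ((k + 1) %% n)%N by [].
  rewrite /wordlen vk.
  (* For k = n - 1 the successor wraps to 0, whose word length agrees with the formula. *)
  have [h|h] := leqP n (k + 1)%N; last by rewrite modn_small // addn1.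
  have -> : (k + 1 = n)%N by lia.
  by rewrite modnn; lia.
have vP : wordlen (k - 1) = minn k.-1 (n - k.-1).
  have vk : nat_of_ord (k - 1) = ((k + (n - 1) %% n) %% n)%N by [].
  rewrite /wordlen vk.
  rewrite (modn_small (_ : (n - 1 < n)%N)); last by rewrite subn1.
  have -> : (k + (n - 1) = k.-1 + n)%N by lia.
  by rewrite modnDr modn_small //; lia.
by rewrite vS vP /wordlen; split; lia.
Qed.

(** Off the origin this reduces to convexity of [r ^+ wordlen k] away from k = 0. With r = e^(-t) it
    is the positivity of P_t. *)
Lemma cosine_kernel_exp_ge0 (r : R) (z : 'Z_n) :
  0 <= r <= 1 -> 0 <= cosine_kernel (fun k => r ^+ k) z.
Proof.
case/andP=> r0 r1; have [->|z0] := eqVneq z 0.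
  rewrite mulr_ge0 ?invr_ge0 ?ler0n // sumr_ge0 // => k _.
  by rewrite chi0 mulr_ge0 ?exprn_ge0.
apply: cosine_kernel_ge0 => // k k0.
have [] := wordlen_concave k0.
move: (wordlen _) (wordlen (k + 1)) (wordlen (k - 1)) => c a b abc ca cb.
wlog ab : a b abc ca cb / (b <= a)%N.
  by move=> h; case: (leqP b a) => [|/ltnW] ab; [|rewrite [leRHS]addrC];
    apply: h => //; rewrite addnC.
have mono i j : (i <= j)%N -> r ^+ j <= r ^+ i.
  by move=> ij; rewrite ler_wiXn2l ?r0.
have [ac|ac] := leqP a c.
  by have := mono _ _ ac; have := mono _ _ (leq_trans ab ac); lra.
(* Only the exponents c - 1 and c + 1 are left, where the second difference is r^(c-1) (r - 1)^2. *)
case: c abc ca cb ac => [|c] abc ca cb ac; first by lia.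
have -> : b = c by lia.
have -> : a = c.+2 by lia.
rewrite !exprS; have := exprn_ge0 c r0; have := sqr_ge0 (r - 1); nra.
Qed.

(** Minus the word length is convex away from 0. These are the off-diagonal entries of L, with the
    sign that Stroock-Varopoulos requires. *)
Lemma cosine_kernel_id_le0 (z : 'Z_n) : z != 0 ->
  cosine_kernel (fun k => k%:R) z <= 0.
Proof.
move=> z0; have := @cosine_kernel_ge0 (fun k => - k%:R) z.
have -> : cosine_kernel (fun k => - k%:R) z = - cosine_kernel (fun k => k%:R) z.
  rewrite /cosine_kernel -mulrN -sumrN; congr (_ * _).
  by apply: eq_bigr => k _; rewrite mulNr.
rewrite oppr_ge0; apply => // k k0; have [h _ _] := wordlen_concave k0.
by move: h; rewrite -(ler_nat R) natrD natrM; lra.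
Qed.
End characters.

(** * Derivatives and two elementary inequalities *)

Section calculus.
Variable R : realType.
Implicit Types (f g h dh : R -> R).

Lemma is_derive_comp_expR f (x df : R) :
  is_derive x 1 f df -> is_derive x 1 (fun y => expR (f y)) (expR (f x) * df).
Proof.
move=> hf; apply: is_derive_eq (is_derive1_comp (is_derive_expR _) hf) _.
by rewrite mulrC.
Qed.

Lemma is_derive_comp_ln f (x df : R) : 0 < f x ->
  is_derive x 1 f df -> is_derive x 1 (fun y => ln (f y)) (df / f x).
Proof.
move=> fx hf; apply: is_derive_eq (is_derive1_comp (is_derive1_ln fx) hf) _.
by rewrite mulrC.
Qed.

Lemma is_derive_idf (x : R) : is_derive x 1 (fun y : R => y) 1.
Proof. exact: is_derive_id. Qed.

Lemma is_derive_cstf (c x : R) : is_derive x 1 (fun _ : R => c) 0.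
Proof. exact: is_derive_cst. Qed.

Lemma is_derive_addf f g (x df dg : R) : is_derive x 1 f df ->
  is_derive x 1 g dg -> is_derive x 1 (fun y => f y + g y) (df + dg).
Proof. by move=> hf hg; exact: is_deriveD. Qed.

Lemma is_derive_mulf f g (x df dg : R) : is_derive x 1 f df ->
  is_derive x 1 g dg -> is_derive x 1 (fun y => f y * g y)
    (df * g x + f x * dg).
Proof.
move=> hf hg; apply: is_derive_eq (is_deriveM hf hg) _.
by rewrite addrC /GRing.scale /=; congr (_ + _); rewrite mulrC.
Qed.

Lemma is_derive_mulcf f (c x df : R) : is_derive x 1 f df ->
  is_derive x 1 (fun y => c * f y) (c * df).
Proof. by move=> hf; exact: is_deriveZ. Qed.

Lemma is_derive_sumf n (F : 'I_n -> R -> R) (x : R) (dF : 'I_n -> R) :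
  (forall i, is_derive x 1 (F i) (dF i)) ->
  is_derive x 1 (fun y => \sum_i F i y) (\sum_i dF i).
Proof.
move=> hF; rewrite (_ : (fun y => \sum_i F i y) = \sum_i F i).
  exact: is_derive_sum.
by apply/funext => y; rewrite fct_sumE.
Qed.

Lemma is_derive_invf f (x df : R) : f x != 0 -> is_derive x 1 f df ->
  is_derive x 1 (fun y => (f y)^-1) (- df / f x ^+ 2).
Proof.
move=> fx hf; apply: is_derive_eq (is_deriveV fx hf) _.
by rewrite /GRing.scale /= mulNr mulrC mulNr.
Qed.

(** The mean value theorem on either side of a: the factor [x - a] absorbs the orientation. *)
Lemma le_between (h dh : R -> R) (a x : R) :
  (forall c, (a <= c <= x) || (x <= c <= a) ->
     is_derive c 1 h (dh c) /\ 0 <= dh c * (x - a)) -> h a <= h x.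
Proof.
have cont (b d : R) : (forall c, b <= c <= d -> is_derive c 1 h (dh c)) ->
    {within `[b, d]%classic, continuous h}%classic.
  move=> H; apply: derivable_within_continuous => c; rewrite in_itv /= => cbd.
  by have ? := H c cbd; exact: ex_derive.
have [ax|xa|->//] := ltgtP a x => H.
  have [|||c] := @MVT_segment _ h dh a x; first exact: ltW.
  - by move=> c; rewrite in_itv /= => /andP[ac cx]; case: (H c) => //;
    rewrite (ltW ac) (ltW cx).
  - by apply: cont => c acx; case: (H c) => //; rewrite acx.
  rewrite in_itv /= => acx; rewrite -[leRHS](subrK (h a)) => ->.
  by rewrite lerDr; case: (H c) => //; rewrite acx.
have [|||c] := @MVT_segment _ h dh x a; first exact: ltW.
- by move=> c; rewrite in_itv /= => /andP[ac cx]; case: (H c) => //;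
  rewrite (ltW ac) (ltW cx) orbT.
- by apply: cont => c acx; case: (H c) => //; rewrite acx orbT.
rewrite in_itv /= => acx E.
have -> : h x = h a - (h a - h x) by ring.
rewrite E lerBrDr gerDl -oppr_ge0 -mulrN opprB.
by case: (H c) => //; rewrite acx orbT.
Qed.

(** The cubic is the third Taylor polynomial of the left side at 1. The difference divided by x^2 is
    [h], which vanishes at 1 and has derivative 2/3 (1 - 1/y)^3, of the sign of y - 1. *)
Lemma sqr_ln_le (x : R) : 0 < x ->
  x ^+ 2 * ln (x ^+ 2) <= 2 / 3 * x ^+ 3 + x ^+ 2 - 2 * x + 1 / 3.
Proof.
move=> x0; rewrite lnXn // -[ln x *+ 2]mulr_natl.
pose h y : R := 2 / 3 * y + 1 + (- 2 * y^-1 + (1 / 3 * (y^-1 * y^-1) + - 2 *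
  ln y)).
have h1 : h 1 = 0 by rewrite /h ln1; field.
suff : h 1 <= h x.
  rewrite h1 => hx; have := mulr_ge0 (sqr_ge0 x) hx.
  have -> : x ^+ 2 * h x = 2 / 3 * x ^+ 3 + x ^+ 2 - 2 * x + 1 / 3 - x ^+ 2 *
    (2 * ln x).
    by rewrite /h; field; rewrite gt_eqF.
  by rewrite subr_ge0.
apply: (@le_between h (fun y => 2 / 3 * (1 - y^-1) ^+ 3)) => c hc.
have c0 : 0 < c.
  case/orP: hc => /andP[hc _]; first exact: lt_le_trans hc.
  exact: lt_le_trans hc.
have cn0 : c != 0 by rewrite gt_eqF.
split.
  have di : is_derive c 1 (fun y : R => y^-1) (- 1 / c ^+ 2).
    exact: is_derive_invf (is_derive_idf _).
  have dl : is_derive c 1 (fun y : R => ln y) (1 / c).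
    exact: is_derive_comp_ln (is_derive_idf _).
  apply: (@is_derive_eq _ _ _ h _ _ _ _ (is_derive_addf (is_derive_addf
    (is_derive_mulcf (2 / 3) (is_derive_idf c))
    (is_derive_cstf 1 c)) (is_derive_addf (is_derive_mulcf (- 2) di)
      (is_derive_addf
    (is_derive_mulcf (1 / 3) (is_derive_mulf di di)) (is_derive_mulcf (- 2)
      dl))))).
  by field.
have -> : 2 / 3 * (1 - c^-1) ^+ 3 * (x - 1) =
  2 / 3 * (1 - c^-1) ^+ 2 * (c^-1 * ((c - 1) * (x - 1))).
  by field.
rewrite mulr_ge0 //; first by rewrite mulr_ge0 ?sqr_ge0 //; lra.
rewrite mulr_ge0 ?invr_ge0 ?(ltW c0) //.
by case/orP: hc => /andP[h2 h3]; [rewrite mulr_ge0 | rewrite mulr_le0]; lra.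
Qed.

(* With s the half difference of the logarithms, the claim is that
   k s = (q - 2)^2 (cosh (q s) - 1) - q^2 (cosh ((q - 2) s) - 1) >= 0;
   it holds because k 0 = k' 0 = 0 <= k''. *)
Lemma stroock_varopoulos (q a b : R) : 1 < q ->
  4 * (q - 1) * (expR (q / 2 * a) - expR (q / 2 * b)) ^+ 2 <=
  q ^+ 2 * ((expR a - expR b) * (expR ((q - 1) * a) - expR ((q - 1) * b))).
Proof.
move=> q1; wlog ba : a b / b <= a.
  move=> H; case: (leP b a) => [|/ltW] /H //.
  congr (_ <= _); [congr (_ * _)|congr (_ * _)]; ring.
have mulBB (x y z t : R) : (x - y) * (z - t) =
  x * z - x * t - y * z + y * t by ring.
pose s := (a - b) / 2; pose d := (a + b) / 2.
have s0 : 0 <= s by rewrite /s; lra.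
pose E c := is_derive_comp_expR (is_derive_mulcf c (is_derive_idf _)).
(* Each cosh is spelled out as a sum of two exponentials, so [k] is twice the function announced. *)
pose k (y : R) : R := (q - 2) ^+ 2 * (expR (q * y) + (expR (- q * y) + -2))
   + - q ^+ 2 * (expR ((q - 2) * y) + (expR ((2 - q) * y) + -2)).
pose k1 (y : R) : R := (q - 2) ^+ 2 * q * (expR (q * y) + -1 * expR (- q * y))
   + - (q ^+ 2 * (q - 2)) * (expR ((q - 2) * y) + -1 * expR ((2 - q) * y)).
pose k2 (y : R) : R := ((q - 2) * q) ^+ 2 * (expR (q * y) + expR (- q * y) -
   expR ((q - 2) * y) - expR ((2 - q) * y)).
(* Up to a constant square this is 4 sinh y sinh ((q - 1) y), whose factors have the same sign as q
   > 1. *)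
have k2E y : k2 y = ((q - 2) * q) ^+ 2 * ((expR y - expR (- y)) *
    (expR ((q - 1) * y) - expR (- ((q - 1) * y)))).
  rewrite /k2; congr (_ * _); rewrite mulBB -!expRD.
  have -> : y + (q - 1) * y = q * y by ring.
  have -> : - y + (q - 1) * y = (q - 2) * y by ring.
  have -> : - y - (q - 1) * y = - q * y by ring.
  have -> : y - (q - 1) * y = (2 - q) * y by ring.
  by ring.
have k2_ge0 y : 0 <= y -> 0 <= k2 y.
  move=> y0; rewrite k2E mulr_ge0 ?sqr_ge0 // mulr_ge0 // subr_ge0 ler_expR.
    lra.
  have : 0 <= (q - 1) * y by rewrite mulr_ge0 //; lra.
  lra.
have k1_ge0 y : 0 <= y -> 0 <= k1 y.
  move=> y0; have -> : 0 = k1 0 by rewrite /k1 !mulr0 expR0; ring.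
  apply: (@le_between k1 k2) => c hc.
  have c0 : 0 <= c by case/orP: hc => /andP[]; lra.
  split; last by rewrite subr0 mulr_ge0 ?k2_ge0.
  apply: is_derive_eq (is_derive_addf (is_derive_mulcf _ (is_derive_addf (E _ _)
    (is_derive_mulcf (-1) (E _ _)))) (is_derive_mulcf _ (is_derive_addf (E _ _)
    (is_derive_mulcf (-1) (E _ _))))) _.
  by rewrite /k2; ring.
have k_ge0 : 0 <= k s.
  have -> : 0 = k 0 by rewrite /k !mulr0 expR0; ring.
  apply: (@le_between k k1) => c hc.
  have c0 : 0 <= c by case/orP: hc => /andP[]; lra.
  split; last by rewrite subr0 mulr_ge0 ?k1_ge0.
  apply: is_derive_eq (is_derive_addf (is_derive_mulcf _ (is_derive_addf (E _ _)
    (is_derive_addf (E _ _) (is_derive_cstf _ _)))) (is_derive_mulcf _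
      (is_derive_addf (E _ _)
    (is_derive_addf (E _ _) (is_derive_cstf _ _))))) _.
  by rewrite /k1; ring.
rewrite -subr_ge0.
(* e^(q d) factors out, by 4 (q - 1) = q^2 - (q - 2)^2. *)
have -> : q ^+ 2 * ((expR a - expR b) * (expR ((q - 1) * a) - expR ((q - 1) *
  b))) -
   4 * (q - 1) * (expR (q / 2 * a) - expR (q / 2 * b)) ^+ 2 =
     expR (q * d) * k s.
  rewrite [(_ - _) ^+ 2]expr2 !mulBB -!expRD /k.
  rewrite [RHS]mulrDr ![expR (q * d) * (_ * _)]mulrCA ![expR (q * d) *
    (_ + _)]mulrDr -!expRD.
  rewrite /s /d.
  set A := expR (q * a); set B := expR (q * b).
  have -> : a + (q - 1) * a = q * a by ring.
  have -> : b + (q - 1) * b = q * b by ring.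
  have -> : q / 2 * a + q / 2 * a = q * a by field.
  have -> : q / 2 * b + q / 2 * b = q * b by field.
  have -> : q / 2 * b + q / 2 * a = q * ((a + b) / 2) by field.
  have -> : q / 2 * a + q / 2 * b = q * ((a + b) / 2) by field.
  have -> : q * ((a + b) / 2) + q * ((a - b) / 2) = q * a by field.
  have -> : q * ((a + b) / 2) + - q * ((a - b) / 2) = q * b by field.
  have -> : q * ((a + b) / 2) + (q - 2) * ((a - b) / 2) =
    b + (q - 1) * a by field.
  have -> : q * ((a + b) / 2) + (2 - q) * ((a - b) / 2) =
    a + (q - 1) * b by field.
  rewrite -/A -/B; ring.
by rewrite mulr_ge0 // expR_ge0.
Qed.

End calculus.

(** * Log-Sobolev inequality and hypercontractivity *)

Section log_sobolev.
Variables (R : realType) (m : nat).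
Local Notation n := m.+2.
Hypothesis n4 : (4 <= n)%N.
Implicit Types (f : 'Z_n -> R).
Local Notation L := (multiplier (fun k : nat => k%:R : R)).

Lemma meanD f g : mean (fun x => f x + g x) = mean f + mean g.
Proof. by rewrite /mean big_split mulrDr. Qed.

Lemma meanZ (c : R) f : mean (fun x => c * f x) = c * mean f.
Proof. by rewrite /mean -mulr_sumr mulrCA. Qed.

Lemma mean_cst (c : R) : mean (fun _ : 'Z_n => c) = c.
Proof.
by rewrite /mean sumr_const card_ord -[c *+ _]mulr_natl mulKf // pnatr_eq0.
Qed.

Lemma eq_mean f g : f =1 g -> mean f = mean g.
Proof. by move=> E; congr (_ * _); apply: eq_bigr => x _. Qed.

Lemma ler_mean f g : (forall x, f x <= g x) -> mean f <= mean g.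
Proof. by move=> h; rewrite ler_wpM2l ?invr_ge0 ?ler0n // ler_sum. Qed.

Lemma mean_gt0 f : (forall x, 0 < f x) -> 0 < mean f.
Proof.
move=> h; rewrite mulr_gt0 ?invr_gt0 ?ltr0n // (bigD1 0) //=.
by rewrite ltr_pwDl // sumr_ge0 // => x _; exact: ltW.
Qed.

Lemma log_sobolev_unit f : (forall x, 0 < f x) ->
  mean (fun x => f x ^+ 2) = 1 ->
  mean (fun x => f x ^+ 2 * ln (f x ^+ 2)) <= 2 * mean (fun x => f x * L f x).
Proof.
move=> f0 f21; pose a := mean f; pose g x := f x - a.
have a0 : 0 < a by exact: mean_gt0.
have g2 : mean (fun x => g x ^+ 2) = 1 - a ^+ 2.
  rewrite (eq_mean (_ : _ =1 fun x => f x ^+ 2 + (- 2 * a * f x + a ^+ 2)));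
    last first.
    by move=> x; rewrite /g; ring.
  by rewrite !meanD mean_cst meanZ f21 -/a; ring.
have f3 : mean (fun x => f x ^+ 3) =
  mean (fun x => g x ^+ 3) + 3 * a - 2 * a ^+ 3.
  rewrite (eq_mean (_ : _ =1 fun x => g x ^+ 3 + (3 * a * f x ^+ 2 + (- 3 *
    a ^+ 2 * f x + a ^+ 3)))); last first.
    by move=> x; rewrite /g; ring.
  by rewrite !meanD mean_cst !meanZ f21 -/a; ring.
pose G k := Normc.normc (fourier_coef (fun x => (g x)%:C) k).
have G0 : G 0 = 0.
  rewrite /G fourier_coef0 normc_real (_ : mean g = 0) ?normr0 //.
  by rewrite meanD mean_cst subrr.
have GN k : G (- k) = G k by rewrite /G fourier_coefN normc_conj.
have Gge0 k : 0 <= G k by exact: normc_ge0.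
have := cubic_bound Gge0 G0 GN n4.
have Gf k : k != 0 -> G k = Normc.normc (fourier_coef (fun x => (f x)%:C) k).
  by move=> k0; rewrite /G fourier_subC.
have EL : mean (fun x => f x * L f x) =
  \sum_(k : 'Z_n) (wordlen k)%:R * G k ^+ 2.
  rewrite mean_multiplier; apply: eq_bigr => k _.
  have [-> | k0] := eqVneq k 0; first by rewrite /wordlen min0n !mul0r.
  by rewrite Gf.
have -> : \sum_(k : 'Z_n) ((wordlen k)%:R - 1) * G k ^+ 2 =
    mean (fun x => f x * L f x) - (1 - a ^+ 2).
  rewrite EL -g2 mean_sqr -sumrB; apply: eq_bigr => k _;
    rewrite mulrBl mul1r //.
rewrite -[\sum_(k : 'Z_n) G k ^+ 2]mean_sqr g2.
have g3 := mean_cube_le g; rewrite -/G in g3.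
have : mean (fun x => f x ^+ 2 * ln (f x ^+ 2)) <=
    2 / 3 * mean (fun x => f x ^+ 3) + 1 - 2 * a + 1 / 3.
  apply: le_trans (ler_mean (fun x => sqr_ln_le (f0 x))) _.
  rewrite (eq_mean (_ : _ =1 fun x => 2 / 3 * f x ^+ 3 + (f x ^+ 2 + (- 2 *
    f x + 1 / 3)))); last first.
    by move=> x; ring.
  by rewrite !meanD mean_cst !meanZ f21 -/a; lra.
rewrite f3.
(* 1 - a^2 is the variance of f. *)
have a1 : a <= 1.
  have : 0 <= 1 - a ^+ 2 by rewrite -g2 -(mean_cst 0); apply: ler_mean => x;
    apply: sqr_ge0.
  by rewrite subr_ge0 expr_le1 // ltW.
(* After all substitutions the excess over 2 <f, L f> is at most one sixth of this polynomial. *)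
have : (a - 1) ^+ 3 * (3 * a + 1) <= 0.
  rewrite mulr_le0_ge0 //; last by lra.
  by rewrite exprS mulr_le0_ge0 ?sqr_ge0 //; lra.
have -> : (a - 1) ^+ 3 * (3 * a + 1) =
  3 * a ^+ 4 - 8 * a ^+ 3 + 6 * a ^+ 2 - 1 by ring.
move: (mean _) (mean _) (mean _) g3 => x y z g3 h1 h2 h3.
have := g3; lra.
Qed.
End log_sobolev.

(** * Gross's argument along the semigroup, for positive functions *)

Section hypercontractivity.
Variables (R : realType) (m : nat).
Local Notation n := m.+2.
Implicit Types (f u : 'Z_n -> R).
Local Notation L := (multiplier (fun k : nat => k%:R : R)).

Lemma multiplierZ phi (c : R) f x :
  multiplier phi (fun y => c * f y) x = c * multiplier phi f x.
Proof. by rewrite mulr_sumr; apply: eq_bigr => y _; rewrite mulrCA. Qed.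

(** Both sides are homogeneous of degree two, so dividing f by its L_2 norm reduces to
    [log_sobolev_unit]. *)
Lemma log_sobolev f : (4 <= n)%N -> (forall x, 0 < f x) ->
  mean (fun x => f x ^+ 2 * ln (f x ^+ 2)) -
    mean (fun x => f x ^+ 2) * ln (mean (fun x => f x ^+ 2)) <=
  2 * mean (fun x => f x * L f x).
Proof.
move=> n4 f0; set S := mean (fun x => f x ^+ 2);
  have S0 : 0 < S by apply: mean_gt0 => x; rewrite exprn_gt0.
pose c := (Num.sqrt S)^-1.
have c0 : 0 < c by rewrite invr_gt0 sqrtr_gt0.
have c2 : c ^+ 2 = S^-1 by rewrite exprVn sqr_sqrtr // ltW.
have := @log_sobolev_unit R m n4 (fun x => c *
  f x) (fun x => mulr_gt0 c0 (f0 x)).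
rewrite (eq_mean (_ : _ =1 fun x => c ^+ 2 * f x ^+ 2)); last by move=> x;
  rewrite exprMn.
rewrite meanZ c2 mulVf ?gt_eqF // => /(_ erefl).
rewrite (eq_mean (_ : _ =1 fun x =>
    S^-1 * (f x ^+ 2 * ln (f x ^+ 2) + - ln S * f x ^+ 2))); last first.
  move=> x; rewrite exprMn c2 lnM ?posrE ?invr_gt0 ?exprn_gt0 // lnV ?posrE //.
  by ring.
rewrite meanZ meanD meanZ -/S.
rewrite [X in _ <= 2 * X](eq_mean (_ : _ =1 fun x => S^-1 * (f x * L f x)));
  last first.
  by move=> x; rewrite multiplierZ -c2; ring.
rewrite meanZ [X in _ <= X]mulrCA ler_pM2l ?invr_gt0 //.
by rewrite mulNr [_ * S]mulrC.
Qed.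

(** The log-Sobolev inequality for u^(q/2), followed by a comparison of Dirichlet forms term by
    term. The second conjunct is what lets [lam <= 1] be used in [hypercontractive_pos]. *)
Lemma log_sobolev_power (q : R) u :
  (4 <= n)%N -> 1 < q -> (forall x, 0 < u x) ->
  2 * (q - 1) * (mean (fun x => expR (q * ln (u x)) * (q * ln (u x))) -
     mean (fun x => expR (q * ln (u x))) *
     ln (mean (fun x => expR (q * ln (u x))))) <=
  q ^+ 2 * mean (fun x => expR ((q - 1) * ln (u x)) * L u x) /\
  0 <= mean (fun x => expR ((q - 1) * ln (u x)) * L u x).
Proof.
move=> n4 q1 u0; set S := mean (fun x => expR (q * ln (u x)));
  pose v x := expR (q / 2 * ln (u x)).
have v2 x : v x ^+ 2 = expR (q * ln (u x)).
  by rewrite expr2 -expRD; congr expR; field.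
have := log_sobolev n4 (fun x => expR_gt0 (q / 2 * ln (u x))).
rewrite -/v /= (eq_mean (_ : _ =1 fun x => expR (q * ln (u x)) * (q *
  ln (u x)))); last first.
  by move=> x; rewrite v2 expRK.
rewrite (eq_mean v2) -/S => ent.
have vL_ge0 : 0 <= mean (fun x => v x * L v x).
  by rewrite mean_multiplier sumr_ge0 // => k _;
    rewrite mulr_ge0 ?sqr_ge0 ?ler0n.
have SV : 4 * (q - 1) * mean (fun x => v x * L v x) <=
    q ^+ 2 * mean (fun x => expR ((q - 1) * ln (u x)) * L u x).
  rewrite !mean_multiplier_diff // !mulNr !mulrN lerN2 [leLHS]mulrCA
    [leRHS]mulrCA.
  rewrite ler_wpM2l ?invr_ge0 ?mulr_ge0 ?ler0n // !mulr_sumr;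
    apply: ler_sum => x _.
  rewrite !mulr_sumr; apply: ler_sum => y _.
  have [->|xy] := eqVneq x y; first by rewrite !subrr !(mul0r, mulr0).
  rewrite [leLHS]mulrCA [leRHS]mulrCA ler_wnM2l //.
    by rewrite cosine_kernel_id_le0 // subr_eq0.
  have := stroock_varopoulos (ln (u x)) (ln (u y)) q1.
  by rewrite !lnK ?posrE // -expr2.
split; last first.
  have q0 : 0 < q ^+ 2 by rewrite exprn_gt0 //; lra.
  by rewrite -(pmulr_rge0 _ q0) (le_trans _ SV) // mulr_ge0 //; lra.
apply: le_trans SV.
have -> : 4 * (q - 1) * mean (fun x => v x * L v x) =
   2 * (q - 1) * (2 * mean (fun x => v x * L v x)) by ring.
by rewrite ler_wpM2l // mulr_ge0 //; lra.
Qed.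

Definition poisson (s : R) f := multiplier (fun k => expR (- s * k%:R)) f.

Lemma poisson_kernel_ge0 (s : R) (z : 'Z_n) :
  0 <= s -> 0 <= cosine_kernel (fun k => expR (- s * k%:R)) z.
Proof.
move=> s0; have := @cosine_kernel_exp_ge0 R m (expR (- s)) z.
rewrite expR_ge0 -[X in _ <= X]expR0 ler_expR oppr_le0 s0 => /(_ isT).
congr (_ <= _ * _); apply: eq_bigr => k _.
by rewrite expRM_natr.
Qed.

(** The kernel is nonnegative of total mass 1, so it cannot vanish everywhere. *)
Lemma poisson_gt0 (s : R) f x :
  0 <= s -> (forall y, 0 < f y) -> 0 < poisson s f x.
Proof.
move=> s0 f0; have K0 y := poisson_kernel_ge0 (x - y) s0.
rewrite lt_neqAle eq_sym; apply/andP; split; last first.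
  by apply: sumr_ge0 => y _; rewrite mulr_ge0 // ltW.
apply/negP => /eqP /psumr_eq0P H.
have := sum_cosine_kernel (fun k => expR (- s * k%:R)) x.
rewrite mulr0 expR0 big1 => [/eqP|y _]; first by rewrite eq_sym oner_eq0.
have /eqP := H (fun y _ => mulr_ge0 (K0 y) (ltW (f0 y))) y isT.
by rewrite mulf_eq0 (gt_eqF (f0 y)) orbF => /eqP.
Qed.

Lemma is_derive_poisson (s : R) f x :
  is_derive s 1 (fun s => poisson s f x) (- L (poisson s f) x).
Proof.
have -> : - L (poisson s f) x = \sum_(y : 'Z_n) (n%:R^-1 * \sum_(k : 'Z_n)
     expR (- s * (wordlen k)%:R) * (- (wordlen k)%:R) *
       complex.Re (chi R k (x - y))) * f y.
  rewrite multiplier_comp -sumrN; apply: eq_bigr => y _.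
  rewrite -mulNr -mulrN -sumrN; congr (_ * _ * _); apply: eq_bigr => k _; ring.
apply: is_derive_sumf => y.
rewrite (_ : (fun s => _) = fun s => f y * (n%:R^-1 * \sum_(k : 'Z_n)
     complex.Re (chi R k (x - y)) * expR (- (wordlen k)%:R * s))); last first.
  apply/funext => s'; rewrite mulrC; congr (_ * (_ * _)); apply: eq_bigr => k _.
  by rewrite mulrC; congr (_ * expR _); ring.
have D (k : 'Z_n) := is_derive_mulcf (complex.Re (chi R k (x - y)))
  (is_derive_comp_expR (is_derive_mulcf (- (wordlen k)%:R) (is_derive_idf s))).
apply: is_derive_eq (is_derive_mulcf (f y) (is_derive_mulcf _ (is_derive_sumf
  D))) _.
rewrite mulrC; congr (_ * _ * _); apply: eq_bigr => k _.
rewrite [- s * _](_ : _ = - (wordlen k)%:R * s); last by ring.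
by ring.
Qed.

Lemma poisson0 f x : poisson 0 f x = f x.
Proof.
rewrite -[RHS](multiplier1 f); apply: eq_bigr => y _; congr (_ * _ * _).
by apply: eq_bigr => k _; rewrite oppr0 mul0r expR0.
Qed.

Lemma is_derive_mean (F : R -> 'Z_n -> R) (s : R) (dF : 'Z_n -> R) :
  (forall x, is_derive s 1 (fun s => F s x) (dF x)) ->
  is_derive s 1 (fun s => mean (F s)) (mean dF).
Proof. by move=> h; apply: is_derive_mulcf; exact: is_derive_sumf. Qed.

(* Gross: along q(s) = 1 + (p - 1) exp (2 lam s) the norm ||P_s f||_(q(s)) is
   nonincreasing; lam <= 1 is chosen so that q(t) = q. *)
Lemma hypercontractive_pos (p q t : R) f : (4 <= n)%N ->
  1 < p -> p <= q -> 0 <= t -> 1 / 2 * ln ((q - 1) / (p - 1)) <= t ->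
  (forall x, 0 < f x) ->
  ln (mean (fun x => expR (q * ln (poisson t f x)))) / q <=
  ln (mean (fun x => expR (p * ln (f x)))) / p.
Proof.
move=> n4 p1 pq t0 ht f0.
have p10 : 0 < p - 1 by lra.
have q10 : 0 < q - 1 by lra.
have r1 : 1 <= (q - 1) / (p - 1) by rewrite ler_pdivlMr //; lra.
have r0 : 0 < (q - 1) / (p - 1) by exact: lt_le_trans r1.
have lr0 : 0 <= ln ((q - 1) / (p - 1)) by exact: ln_ge0.
(* [lam] divides by t, so t = 0 is treated apart; there the hypothesis forces q = p. *)
move: t0; rewrite le_eqVlt => /predU1P[t0|t0].
  have pq' : q = p.
    have : ln ((q - 1) / (p - 1)) <= ln 1 by rewrite ln1; lra.
    by rewrite ler_ln ?posrE // ler_pdivrMr //; lra.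
  rewrite pq' -t0 (eq_mean (_ : _ =1 fun x => expR (p * ln (f x)))) // => x.
  by rewrite poisson0.
pose lam := ln ((q - 1) / (p - 1)) / (2 * t).
have lam0 : 0 <= lam by rewrite divr_ge0 // mulr_ge0 // ltW.
have lam1 : lam <= 1 by rewrite ler_pdivrMr; lra.
pose Q (s : R) := 1 + (p - 1) * expR (2 * lam * s).
pose dQ (s : R) := (p - 1) * (expR (2 * lam * s) * (2 * lam * 1)).
have Q1 s : 1 < Q s by rewrite ltrDl mulr_gt0 ?expR_gt0.
have dQE s : dQ s = lam * (2 * (Q s - 1)) by rewrite /dQ /Q; ring.
have Q0 : Q 0 = p by rewrite /Q mulr0 expR0; ring.
have Qt : Q t = q.
  rewrite /Q /lam (_ : 2 * _ * t =
    ln ((q - 1) / (p - 1))); last by field; rewrite gt_eqF.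
  by rewrite lnK ?posrE //; field; rewrite gt_eqF.
have hQ (s : R) : is_derive s 1 Q (dQ s).
  apply: is_derive_eq (is_derive_addf (is_derive_cstf 1 s) (is_derive_mulcf
    (p - 1) (is_derive_comp_expR (is_derive_mulcf (2 * lam) (is_derive_idf s))))) _.
  by rewrite /dQ add0r.
pose u s x := poisson s f x.
pose S (s : R) := mean (fun x => expR (Q s * ln (u s x))).
pose dS (s : R) := mean (fun x => expR (Q s * ln (u s x)) *
   (dQ s * ln (u s x) + Q s * (- L (u s) x / u s x))).
have hS (s : R) : 0 <= s -> is_derive s 1 S (dS s).
  move=> s0; apply: is_derive_mean => x; apply: is_derive_comp_expR.
  apply: is_derive_mulf (hQ s) (is_derive_comp_ln (poisson_gt0 x s0 f0) _).
  exact: is_derive_poisson.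
have S0 s : 0 < S s by apply: mean_gt0 => x; exact: expR_gt0.
(* Minus the logarithm of the norm, so that the claim becomes an increase. *)
pose h (s : R) := -1 * (ln (S s) * (Q s)^-1).
suff : h 0 <= h t.
  rewrite /h /S Q0 Qt !mulN1r lerN2; congr (_ <= ln _ / _).
  by apply: eq_mean => x; rewrite /u poisson0.
apply: (@le_between _ h (fun s => -1 * (dS s / S s * (Q s)^-1 + ln (S s) *
  (- dQ s / Q s ^+ 2)))) => s hs.
have s0 : 0 <= s by case/orP: hs => /andP[]; lra.
have QN : Q s != 0 by rewrite gt_eqF // (lt_trans _ (Q1 s)).
split.
  exact: is_derive_mulcf (is_derive_mulf (is_derive_comp_ln (S0 s) (hS s s0))
    (is_derive_invf QN (hQ s))).
rewrite subr0 mulr_ge0 ?(ltW t0) //.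
have u0 x : 0 < u s x by exact: poisson_gt0.
have [LS E0] := log_sobolev_power n4 (Q1 s) u0.
(* An entropy part from the moving exponent and an energy part from the heat equation. *)
have dSE : Q s * dS s =
    dQ s * mean (fun x => expR (Q s * ln (u s x)) * (Q s * ln (u s x)))
    - Q s ^+ 2 * mean (fun x => expR ((Q s - 1) * ln (u s x)) * L (u s) x).
  rewrite /dS -!meanZ -[- mean _]mulN1r -meanZ -meanD; apply: eq_mean => x.
  rewrite mulrBl mul1r expRB lnK ?posrE //; field.
  by rewrite gt_eqF.
have -> : -1 * (dS s / S s * (Q s)^-1 + ln (S s) * (- dQ s / Q s ^+ 2)) =
    (dQ s * (S s * ln (S s)) - Q s * dS s) / (S s * Q s ^+ 2).
  by field; rewrite QN gt_eqF.
rewrite divr_ge0 //; last by rewrite mulr_ge0 ?sqr_ge0 // ltW.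
rewrite dSE dQE; move: LS E0; rewrite -/(S s).
set M := mean _; set E := mean _; set T := S s * ln (S s) => LS E0.
(* The exponent moves at [lam] times the critical speed; the energy, being nonnegative, dominates
   its multiple by [lam <= 1]. *)
have h1 := ler_wpM2l lam0 LS.
have h2 : lam * (Q s ^+ 2 * E) <= Q s ^+ 2 * E.
  by rewrite ler_piMl // mulr_ge0 // sqr_ge0.
lra.
Qed.
End hypercontractivity.

(** * Reduction of complex functions to positive ones *)

Section Lp_norm.
Variables (R : realType) (m : nat).
Local Notation n := m.+2.
Implicit Types (f u : 'Z_n -> R) (F : 'Z_n -> R[i]).

Lemma poisson_semigroupE (t : R) F x :
  poisson_semigroup t F x =
  \sum_(y : 'Z_n) (cosine_kernel (fun k => expR (- t * k%:R)) (x - y))%:C * F y.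
Proof. exact: (sum_fourier_multiplier (fun k => expR (- t * k%:R))). Qed.

(** The triangle inequality under a nonnegative kernel. A majorant [u] in place of |F| leaves room
    for a strictly positive one. *)
Lemma normc_poisson_semigroup_le (t : R) F u x : 0 <= t ->
  (forall y, Normc.normc (F y) <= u y) ->
  Normc.normc (poisson_semigroup t F x) <= poisson t u x.
Proof.
move=> t0 Fu; rewrite poisson_semigroupE.
apply: le_trans (ler_normc_sum _) _; apply: ler_sum => y _.
rewrite Normc.normcM normc_real ger0_norm ?poisson_kernel_ge0 //.
by rewrite ler_wpM2l ?poisson_kernel_ge0.
Qed.

Lemma powRE (a x : R) : 0 < a -> a `^ x = expR (x * ln a).
Proof. by move=> a0; rewrite /powR gt_eqF. Qed.

Lemma Lpnorm_powR (p : R) F : 0 < p ->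
  Lpnorm p F `^ p = mean (fun x => Normc.normc (F x) `^ p).
Proof.
move=> p0; rewrite -powRrM mulVf ?gt_eqF // powRr1 //.
by rewrite mulr_ge0 ?invr_ge0 ?ler0n // sumr_ge0 // => x _; exact: powR_ge0.
Qed.

(** The positive case involves logarithms, so |F| is replaced by max (|F|, e). Comparing p-th powers
    makes the cost an additive d = e^p, with d > 0 arbitrary. *)
Lemma hypercontractive_complex (p q t : R) F : (4 <= n)%N ->
  1 < p -> p <= q -> 0 <= t -> 1 / 2 * ln ((q - 1) / (p - 1)) <= t ->
  Lpnorm q (poisson_semigroup t F) <= Lpnorm p F.
Proof.
move=> n4 p1 pq t0 ht; have p0 : 0 < p by lra.
have q0 : 0 < q by lra.
have N0 (r : R) G : 0 <= @Lpnorm R n r G by exact: powR_ge0.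
have pn0 : p != 0 by rewrite gt_eqF.
have K (r : R) : 0 <= r -> r = (r `^ p) `^ p^-1 by move=> r0;
  rewrite -powRrM mulfV // powRr1.
rewrite (K _ (N0 q (poisson_semigroup t F))) (K _ (N0 p F)).
apply: ge0_ler_powR; [by rewrite invr_ge0 ltW | by rewrite nnegrE powR_ge0 |
  by rewrite nnegrE powR_ge0 |].
rewrite [leRHS](Lpnorm_powR F p0); apply/ler_addgt0Pr => d d0.
pose e := d `^ p^-1; have e0 : 0 < e by exact: powR_gt0.
have ep : e `^ p = d by rewrite -powRrM mulVf // powRr1 // ltW.
pose u x := Num.max (Normc.normc (F x)) e.
have u0 x : 0 < u x by rewrite lt_max e0 orbT.
have Pu0 x : 0 < poisson t u x by exact: poisson_gt0.
have mexp0 (r : R) (v : 'Z_n -> R) : 0 < mean (fun x => expR (r * ln (v x))).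
  by apply: mean_gt0 => x; exact: expR_gt0.
apply: (@le_trans _ _ (mean (fun x => expR (p * ln (u x))))); last first.
  rewrite -(mean_cst m d) -meanD; apply: ler_mean => x; rewrite -powRE // /u.
  case: (leP (Normc.normc (F x)) e) => _; last by rewrite lerDl ltW.
  by rewrite ep lerDr powR_ge0.
have Lq : Lpnorm q (poisson_semigroup t F) <=
    expR (ln (mean (fun x => expR (q * ln (poisson t u x)))) / q).
  rewrite [_ / q]mulrC -powRE //.
  apply: ge0_ler_powR; [by rewrite invr_ge0 ltW | | by rewrite nnegrE ltW |].
    by rewrite nnegrE mulr_ge0 ?invr_ge0 ?ler0n // sumr_ge0 // => x _;
      exact: powR_ge0.
  apply: ler_mean => x; rewrite -powRE //.
  apply: ge0_ler_powR; [exact: ltW | by rewrite nnegrE normc_ge0 | by rewrite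
    nnegrE ltW |].
  by apply: normc_poisson_semigroup_le => // y; rewrite /u le_max lexx.
have Lp := le_trans Lq (_ : _ <= expR (ln (mean (fun x => expR (p *
  ln (u x)))) / p)).
rewrite -[leRHS]lnK ?posrE // -[X in expR X](divfK pn0) expRM.
apply: ge0_ler_powR; [exact: ltW | by rewrite nnegrE N0 | by rewrite nnegrE
  expR_ge0 |].
by apply: Lp; rewrite ler_expR; exact: hypercontractive_pos.
Qed.

End Lp_norm.

(** * Necessity *)

Section necessity.
Variables (R : realType) (m : nat).
Local Notation n := m.+2.

(** Applied to [g = dh] in [contractive_necessity], it turns second-order data at 0 into a sign of
    the first derivative to the right of 0. *)
Lemma near0_lt0 (g : R -> R) (D : R) :
  is_derive (0 : R) 1 g D -> g 0 = 0 -> D < 0 ->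
  exists2 e, 0 < e & forall x, 0 < x < e -> g x < 0.
Proof.
move=> [dg Dg] g0 D0.
have : ((fun h : R => h^-1 *: (g (h *: 1 + 0) - g 0)) @ 0^' --> D)%classic.
  by rewrite -Dg; exact: dg.
move/(cvgr_lt D) => /(_ _ D0) /nbhs_ballP[e /= e0 He].
exists e => // x /andP[x0 xe]; have := He x.
rewrite /ball /= sub0r normrN gtr0_norm // => /(_ xe).
rewrite gt_eqF // => /(_ isT).
by rewrite g0 subr0 addr0 /GRing.scale /= mulr1 pmulr_rlt0 // invr_gt0.
Qed.

Variable c : 'Z_n -> R.
Hypothesis c1 : forall x, `|c x| <= 1.

Lemma pert_gt0 (e : R) x : `|e| < 1 -> 0 < 1 + e * c x.
Proof.
move=> e1; have : `|e * c x| < 1.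
  by rewrite normrM (le_lt_trans _ e1) // ler_piMr.
by rewrite ltr_norml => /andP[]; lra.
Qed.

(** For w = 1 this is the a-th power of the L_a norm of 1 + e c. The weight keeps the family stable
    under d/de, which multiplies w by c and lowers the exponent. *)
Definition pert_mean (w : 'Z_n -> R) (a e : R) : R :=
  mean (fun x => w x * expR (a * ln (1 + e * c x))).

Lemma is_derive_pert_mean w (a e : R) : `|e| < 1 ->
  is_derive e 1 (pert_mean w a) (a * pert_mean (fun x => w x * c x) (a - 1) e).
Proof.
move=> e1; rewrite -meanZ; apply: is_derive_mean => x.
have D : is_derive e 1 (fun e => 1 + e * c x) (c x).
  apply: is_derive_eq (is_derive_addf (is_derive_cstf 1 e)
    (is_derive_mulf (is_derive_idf e) (is_derive_cstf (c x) e))) _.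
  by rewrite mulr0 mul1r add0r addr0.
have p0 := pert_gt0 x e1.
apply: is_derive_eq (is_derive_mulcf (w x) (is_derive_comp_expR
  (is_derive_mulcf a (is_derive_comp_ln (f := fun e => 1 + e * c x) p0 D)))) _.
rewrite mulrBl mul1r expRB lnK ?posrE //; field.
by rewrite gt_eqF.
Qed.

Lemma pert_mean0 w (a : R) : pert_mean w a 0 = mean w.
Proof. by apply: eq_mean => x; rewrite mul0r addr0 ln1 mulr0 expR0 mulr1. Qed.

Lemma pert_mean_gt0 (a e : R) : 0 < pert_mean (fun=> 1) a e.
Proof. by apply: mean_gt0 => x; rewrite mul1r expR_gt0. Qed.

Lemma is_derive_ln_pert_mean (p e : R) : p != 0 -> `|e| < 1 ->
  is_derive e 1 (fun e => ln (pert_mean (fun=> 1) p e) / p)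
    (pert_mean c (p - 1) e / pert_mean (fun=> 1) p e).
Proof.
move=> p0 e1; apply: is_derive_eq (is_derive_mulf (is_derive_comp_ln
  (pert_mean_gt0 p e) (is_derive_pert_mean (fun=> 1) p e1)) (is_derive_cstf
    p^-1 e)) _.
have -> : pert_mean (fun x => 1 * c x) (p - 1) e = pert_mean c (p - 1) e.
  by apply: eq_mean => x; rewrite mul1r.
by field; rewrite p0 gt_eqF // pert_mean_gt0.
Qed.

(** For p != 0 this is the second derivative at 0 of log ||1 + e c||_p; the mean-zero condition
    removes the term from the denominator. *)
Lemma is_derive0_pert_ratio (p : R) : mean c = 0 ->
  is_derive (0 : R) 1 (fun e => pert_mean c (p - 1) e / pert_mean (fun=> 1) p e)
    ((p - 1) * mean (fun x => c x ^+ 2)).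
Proof.
move=> mc0; have e1 : `|0 : R| < 1 by rewrite normr0.
have A0 : pert_mean (fun=> 1) p 0 != 0 by rewrite gt_eqF ?pert_mean_gt0.
apply: is_derive_eq (is_derive_mulf (is_derive_pert_mean c (p - 1) e1)
  (is_derive_invf A0 (is_derive_pert_mean (fun=> 1) p e1))) _.
by rewrite !pert_mean0 mc0 mul0r addr0 mean_cst invr1 mulr1.
Qed.
End necessity.

(** * Testing contractivity on 1 plus a small cosine *)

Section necessity_Zn.
Variables (R : realType) (m : nat).
Local Notation n := m.+2.

Let n1 : (1 < n)%N. Proof. by []. Qed.

Lemma multiplier_cos phi (j x : 'Z_n) :
  multiplier phi (fun y => complex.Re (chi R j y)) x =
  phi (wordlen j) * complex.Re (chi R j x).
Proof.
have : \sum_(y : 'Z_n) (cosine_kernel phi (x - y))%:C * chi R j y =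
    (phi (wordlen j))%:C * chi R j x.
  rewrite -sum_fourier_multiplier (bigD1 j) //= big1 ?addr0 => [|k kj].
    by rewrite /fourier_coef chi_orth // eqxx mulVf ?mulr1 // pnatr_eq0.
  rewrite /fourier_coef chi_orth // eq_sym (negbTE kj) mulr0n.
  by rewrite !mulr0 mul0r.
have ReM (a : R) (z : R[i]) : complex.Re (a%:C * z) = a * complex.Re z.
  by case: z => b d /=; ring.
move/(congr1 (@complex.Re R)); rewrite ReM raddf_sum => <-.
by apply: eq_bigr => y _; symmetry; exact: ReM.
Qed.

Lemma Lpnorm_real_gt0 (p : R) (f : 'Z_n -> R) : (forall x, 0 < f x) ->
  Lpnorm p (fun x => (f x)%:C) =
  expR (ln (mean (fun x => expR (p * ln (f x)))) / p).
Proof.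
move=> f0; rewrite mulrC -powRE; last by apply: mean_gt0 => x; exact: expR_gt0.
congr ((_ * _) `^ _); apply: eq_bigr => x _.
by rewrite normc_real gtr0_norm // powRE.
Qed.

(** P_t multiplies the cosine [c] by r = e^(-t), since 1 has word length 1. So [h], the logarithm of
    ||1 + e c||_p / ||1 + e r c||_q, is nonnegative for |e| < 1 and vanishes at 0 with its
    derivative. Its second derivative there, (p - 1 - (q - 1) r^2) times the mean of c^2, cannot be
    negative. *)
Lemma contractive_necessity (p q t : R) : 1 < p -> p <= q -> 0 <= t ->
  (forall f : 'Z_n -> R[i], Lpnorm q (poisson_semigroup t f) <= Lpnorm p f) ->
  1 / 2 * ln ((q - 1) / (p - 1)) <= t.
Proof.
move=> p1 pq t0 H; pose r := expR (- t).
have r1 : r <= 1 by rewrite -expR0 ler_expR oppr_le0.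
have r0 : 0 < r by exact: expR_gt0.
pose c (x : 'Z_n) := complex.Re (chi R 1 x).
have c1 x : `|c x| <= 1 by rewrite /c chi_cis ler_norml cos_geN1 cos_le1.
pose d x := r * c x.
have d1 x : `|d x| <= 1 by rewrite normrM mulr_ile1 // gtr0_norm.
have w1 : wordlen (1 : 'Z_n) = 1%N by rewrite /wordlen;
  change (minn 1 (n - 1) = 1)%N; lia.
have mc0 : mean c = 0.
  have := chi_orth R n1 1 0; rewrite mulr0n.
  under eq_bigr => x _ do rewrite [chi R 0 x]chiC chi0 conjc1 mulr1.
  move/(congr1 (@complex.Re R)); rewrite raddf_sum => c0.
  by rewrite /mean (c0 : \sum_x c x = 0) mulr0.
have md0 : mean d = 0 by rewrite meanZ mc0 mulr0.
have Pf e x : poisson_semigroup t (fun y => (1 + e * c y)%:C) x =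
  (1 + e * d x)%:C.
  rewrite poisson_semigroupE; under eq_bigr => y _ do rewrite -rmorphM.
  rewrite -rmorph_sum; congr (_%:C).
  transitivity (\sum_(y : 'Z_n) cosine_kernel (fun k => expR (- t *
    k%:R)) (x - y) +
      e * multiplier (fun k => expR (- t * k%:R)) c x).
    by rewrite mulr_sumr -big_split; apply: eq_bigr => y _ /=; ring.
  by rewrite sum_cosine_kernel mulr0 expR0 multiplier_cos w1 mulr1.
pose h (e : R) := ln (pert_mean c (fun=> 1) p e) / p + -1 *
  (ln (pert_mean d (fun=> 1) q e) / q).
pose dh (e : R) := pert_mean c c (p - 1) e / pert_mean c (fun=> 1) p e +
  -1 * (pert_mean d d (q - 1) e / pert_mean d (fun=> 1) q e).
have h_ge0 e : `|e| < 1 -> 0 <= h e.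
  move=> e1; have := H (fun y => (1 + e * c y)%:C).
  rewrite Lpnorm_real_gt0; last by move=> x; exact: (pert_gt0 c1).
  have -> : Lpnorm q (poisson_semigroup t (fun y => (1 + e * c y)%:C)) =
      Lpnorm q (fun x => (1 + e * d x)%:C).
    by congr ((_ * _) `^ _); apply: eq_bigr => x _; rewrite Pf.
  rewrite Lpnorm_real_gt0; last by move=> x; exact: (pert_gt0 d1).
  rewrite ler_expR /h mulN1r subr_ge0; congr (ln _ / _ <= ln _ / _).
    by apply: eq_mean => x; rewrite mul1r.
  by apply: eq_mean => x; rewrite mul1r.
have h'0 : is_derive (0 : R) 1 dh ((p - 1) * mean (fun x => c x ^+ 2) + -1 *
  ((q - 1) * mean (fun x => d x ^+ 2))).
  exact: is_derive_addf (is_derive0_pert_ratio c1 p mc0)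
    (is_derive_mulcf (-1) (is_derive0_pert_ratio d1 q md0)).
have md2 : mean (fun x => d x ^+ 2) = r ^+ 2 * mean (fun x => c x ^+ 2).
  by rewrite -meanZ; apply: eq_mean => x; rewrite exprMn.
have mc2 : 0 < mean (fun x => c x ^+ 2).
  rewrite mulr_gt0 ?invr_gt0 ?ltr0n // (bigD1 0) //= ltr_pwDl //.
    by rewrite /c chi0 expr1n.
  by rewrite sumr_ge0 // => x _; exact: sqr_ge0.
have p10 : 0 < p - 1 by lra.
suff key : (q - 1) * r ^+ 2 <= p - 1.
  have : (q - 1) / (p - 1) <= expR (2 * t).
    rewrite ler_pdivrMr // -(@ler_pM2r _ (r ^+ 2)) ?exprn_gt0 //.
    apply: le_trans key _; rewrite mulrAC -[leLHS]mul1r ler_wpM2r ?(ltW p10) //.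
    by rewrite /r -expRM_natr -expRD [X in expR X](_ : _ = 0) ?expR0 //; ring.
  rewrite -ler_ln ?posrE ?expR_gt0 ?divr_gt0 //; last by lra.
  by rewrite expRK; lra.
rewrite leNgt; apply/negP => lt.
have D0 : (p - 1) * mean (fun x => c x ^+ 2) + -1 * ((q - 1) *
  mean (fun x => d x ^+ 2)) < 0.
  by rewrite md2 mulN1r mulrA -mulrBl nmulr_rlt0 // subr_lt0.
have dh0 : dh 0 = 0 by rewrite /dh !pert_mean0 mc0 md0 !mul0r mulr0 addr0.
have [e e0 He] := near0_lt0 h'0 dh0 D0.
(* Below e for the sign of [dh], below 1 for the positivity of 1 + s c; the mean value theorem on
   [0, s] then gives h s < 0. *)
pose s := Num.min (e / 2) (1 / 2).
have s0 : 0 < s by rewrite lt_min !divr_gt0.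
have se : s < e by rewrite gt_min; apply/orP; left; lra.
have s1 : s < 1 by rewrite gt_min; apply/orP; right; lra.
have hd (x : R) : `|x| < 1 -> is_derive x 1 h (dh x).
  have pn0 : p != 0 by rewrite gt_eqF //; lra.
  have qn0 : q != 0 by rewrite gt_eqF //; lra.
  move=> x1; exact: is_derive_addf (is_derive_ln_pert_mean c1 pn0 x1)
    (is_derive_mulcf (-1) (is_derive_ln_pert_mean d1 qn0 x1)).
have n1' (x : R) : 0 <= x <= s -> `|x| < 1 by move=> /andP[x0 xs];
  rewrite ger0_norm //; lra.
have [||x] := @MVT _ h dh 0 s s0.
- by move=> x; rewrite in_itv /= => /andP[x0 xs]; apply: hd; apply: n1';
  rewrite !ltW.
- apply: derivable_within_continuous => x; rewrite in_itv /= => /n1' x1.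
  by have ? := hd x x1; exact: ex_derive.
rewrite in_itv /= => /andP[x0 xs].
have -> : h 0 = 0 by rewrite /h !pert_mean0 mean_cst ln1 !mul0r mulr0 addr0.
rewrite subr0 => hs.
have : 0 <= h s by apply: h_ge0; apply: n1'; rewrite lexx ltW.
rewrite hs subr0 leNgt nmulr_rlt0 ?s0 //.
by apply: He; rewrite x0 (lt_trans xs).
Qed.
End necessity_Zn.

Theorem theorem1p1 (R : realType) (n : nat) (hn : (4 <= n)%N)
    (p q t : R) (hp : 1 < p) (hpq : p <= q) (ht : 0 <= t) :
  (forall f : 'Z_n -> R[i], Lpnorm q (poisson_semigroup t f) <= Lpnorm p f) <->
  1 / 2 * ln ((q - 1) / (p - 1)) <= t.
Proof.
case: n hn => [|[|m]] hn; [by []|by []|split].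
  exact: (contractive_necessity hp hpq ht).
by move=> h f; exact: (hypercontractive_complex f hn hp hpq ht h).
Qed.
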